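(* Let $n\ge1$, $\Delta_n=1-24n$, and let $\ell\ge5$ be a prime with $v_\ell(\Delta_n)=2k\ge2$. Then for every $(E,C)\in\mathrm{SS}_\ell(6)$, $\ell^k\mid h_{\Delta_n}(E,C)$.
   Context: $\mathrm{SS}_\ell(6)$ is the set of isomorphism classes of pairs $(E,C)$ over $\overline{\mathbb{F}}_\ell$ with $E$ supersingular and $C\subset E$ cyclic of order 6; $R=\mathrm{End}(E,C)=\{\varphi\in\mathrm{End}(E):\varphi(C)\subseteq C\}$ is an Eichler order of level 6 in $B_{\ell,\infty}$. For an order $O$ in an imaginary quadratic field $K$, $\iota:O\hookrightarrow R$ is optimal if $\iota(K)\cap R=\iota(O)$; it is oriented if for each $p\mid 6$, under a fixed identification of $R\otimes\mathbb{Z}_p$ with upper triangular $2\times2$ matrices over $\mathbb{Z}_p$ carrying the stabilizer of $C[p^{v_p(6)}]$ to the upper triangular subgroup, the $(1,1)$-entry of $\iota$ on $O\otimes\mathbb{Z}_p$ equals the structural map induced by a fixed $K\hookrightarrow\mathbb{C}$; additionally, when $\ell$ is nonsplit in $K$ a local orientation at $\ell$ is recorded (an $\ell$-fold multiplicity). $h_{\Delta_n}(E,C)$ is the number of oriented optimal embeddings of the quadratic order of discriminant $\Delta_n$ into $R$ up to $R^\times$-conjugacy.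
   Formalization: For p | 6, ''upper triangular'' is read as upper triangular modulo p^{v_p(6)} (R⊗Z_p has rank 4, so it cannot be the upper triangular matrices over Z_p), and the (1,1)-entry is compared with the structural map modulo p^{v_p(6)}. *)

(* Defs.v *)
From HB Require Import structures.
From mathcomp Require Import all_boot all_order all_algebra all_field.
From mathcomp Require Import ring.
From mathcomp Require Import boolp classical_sets functions cardinality.

Set Implicit Arguments.
Unset Strict Implicit.
Unset Printing Implicit Defensive.

Import Order.TTheory GRing.Theory Num.Theory.
Local Open Scope classical_set_scope.
Local Open Scope ring_scope.

(* Short Weierstrass equations y^2 = x^3 + a x + b. They represent every
   isomorphism class of elliptic curves in characteristic different from 2
   and 3. *)
Record ell_curve (F : fieldType) := EllCurve {
  ecA : F;
  ecB : F;
  ec_smooth : 4%:R * ecA ^+ 3 + 27%:R * ecB ^+ 2 != 0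
}.

Section Points.
Variables (F : fieldType) (E : ell_curve F).

(* [None] is the point at infinity. *)
Definition on_curve (p : option (F * F)) : bool :=
  if p is Some (x, y) then y ^+ 2 == x ^+ 3 + ecA E * x + ecB E else true.

Record ec_point := ECPoint { ec_coord : option (F * F); _ : on_curve ec_coord }.

HB.instance Definition _ := [isSub for ec_coord].
HB.instance Definition _ := [Choice of ec_point by <:].

Definition ec_slope (x1 y1 x2 y2 : F) : F :=
  if x1 == x2 then (3%:R * x1 ^+ 2 + ecA E) / (2%:R * y1)
  else (y2 - y1) / (x2 - x1).

Definition ec_add_coord (p q : option (F * F)) : option (F * F) :=
  match p, q with
  | None, _ => q
  | _, None => p
  | Some (x1, y1), Some (x2, y2) =>
      if (x1 == x2) && (y1 == - y2) then None
      else let s := ec_slope x1 y1 x2 y2 in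
           let x3 := s ^+ 2 - x1 - x2 in
           Some (x3, s * (x1 - x3) - y1)
  end.

Lemma ec_add_on_curve (p q : option (F * F)) :
  on_curve p -> on_curve q -> on_curve (ec_add_coord p q).
Proof.
case: p => [[x1 y1]|] //; case: q => [[x2 y2]|] //=.
move=> /eqP h1 /eqP h2; case: ifP => //= /negbT hn.
rewrite /ec_slope; case: (eqVneq x1 x2) hn => [e|ne] /= hn.
  subst x2.
  have hy : y1 = y2.
    have : (y1 - y2) * (y1 + y2) == 0.
      by rewrite -subr_sqr h1 h2 subrr.
    rewrite mulf_eq0 subr_eq0 addr_eq0 => /orP[/eqP //|hh].
    by rewrite hh in hn.
  subst y2.
  have y2n0 : 2%:R * y1 != 0.
    by rewrite mulr_natl mulr2n addr_eq0.
  set s := _ / _.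
  have hs : s * (2%:R * y1) = 3%:R * x1 ^+ 2 + ecA E by rewrite divfK.
  have hb : ecB E = y1 ^+ 2 - x1 ^+ 3 - ecA E * x1 by rewrite h1; ring.
  have ha : ecA E = s * (2%:R * y1) - 3%:R * x1 ^+ 2 by rewrite hs; ring.
  by apply/eqP; rewrite hb ha; ring.
have dn0 : x2 - x1 != 0 by rewrite subr_eq0 eq_sym.
set s := _ / _.
have hs : s * (x2 - x1) = y2 - y1 by rewrite divfK.
have hy2 : y2 = y1 + s * (x2 - x1) by rewrite hs; ring.
have ha : ecA E = s * (y1 + y2) - (x1 ^+ 2 + x1 * x2 + x2 ^+ 2).
  apply: (mulfI dn0).
  have -> : (x2 - x1) * ecA E
      = (y2 ^+ 2 - y1 ^+ 2) - (x2 ^+ 3 - x1 ^+ 3) by rewrite h1 h2; ring.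
  by rewrite hy2; ring.
have hb : ecB E = y1 ^+ 2 - x1 ^+ 3 - ecA E * x1 by rewrite h1; ring.
by apply/eqP; rewrite hb ha hy2; ring.
Qed.

Definition ec_zero : ec_point := @ECPoint None isT.

Definition ec_add (P Q : ec_point) : ec_point :=
  ECPoint (ec_add_on_curve (valP P) (valP Q)).

Definition ec_mul (m : nat) (P : ec_point) : ec_point :=
  iter m (ec_add P) ec_zero.

(* Homogeneous coordinates in the projective plane. *)
Definition proj_coord (P : ec_point) : F * F * F :=
  if ec_coord P is Some (x, y) then (x, y, 1) else (0, 1, 0).

Definition same_proj (u v : F * F * F) : Prop :=
  exists2 c : F, c != 0 &
    [/\ u.1.1 = c * v.1.1, u.1.2 = c * v.1.2 & u.2 = c * v.2].

Definition eval3 (f : {poly {poly F}} * {poly {poly F}} * {poly {poly F}})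
    (x y : F) : F * F * F :=
  (f.1.1.[y%:P].[x], f.1.2.[y%:P].[x], f.2.[y%:P].[x]).

(* [phi] is given on a nonempty Zariski-open subset of E by
   (x, y) |-> [X(x, y) : Y(x, y) : Z(x, y)] with polynomials X, Y, Z. *)
Definition given_by_rational_functions (phi : ec_point -> ec_point) : Prop :=
  exists f : {poly {poly F}} * {poly {poly F}} * {poly {poly F}},
    (exists P x y, ec_coord P = Some (x, y) /\ eval3 f x y <> (0, 0, 0)) /\
    (forall P x y, ec_coord P = Some (x, y) -> eval3 f x y <> (0, 0, 0) ->
       same_proj (eval3 f x y) (proj_coord (phi P))).

(* Over an algebraically closed field these are exactly the endomorphisms of E
   (the zero map included): a rational map from a smooth curve to a projective
   variety is regular, and a group homomorphism that agrees with a regular map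
   outside a finite set is equal to it. *)
Definition ec_End : set (ec_point -> ec_point) :=
  [set phi | (forall P Q, phi (ec_add P Q) = ec_add (phi P) (phi Q)) /\
             given_by_rational_functions phi].

Definition ec_addf (phi psi : ec_point -> ec_point) : ec_point -> ec_point :=
  fun P => ec_add (phi P) (psi P).

Definition ec_mulf (m : nat) (phi : ec_point -> ec_point)
  : ec_point -> ec_point := fun P => ec_mul m (phi P).

(* The field is meant to be algebraically closed of characteristic l. *)
Definition supersingular (l : nat) : Prop :=
  forall P, ec_mul l P = ec_zero -> P = ec_zero.

Definition cyclic_of_order (m : nat) (C : set ec_point) : Prop :=
  exists P, [/\ C = [set ec_mul i P | i in [set: nat]],
                ec_mul m P = ec_zero
              & forall i, (0 < i < m)%N -> ec_mul i P <> ec_zero].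

Definition ec_End_level (C : set ec_point) : set (ec_point -> ec_point) :=
  [set phi | ec_End phi /\ forall P, C P -> C (phi P)].

End Points.

(* The p-adic integers (p > 1): the closure of the integers in the product of
   the Z/p^(m+1), that is the inverse limit of these rings. *)
Section Padic.
Variable p : nat.

Definition padic_coherent (x : forall m : nat, 'Z_(p ^ m.+1)) : Prop :=
  forall m, exists z : int, forall i, (i <= m)%N -> x i = z%:~R.

Record padic := Padic {
  residue : forall m : nat, 'Z_(p ^ m.+1);
  padicP : padic_coherent residue
}.

Lemma padic_ext (x y : padic) : (forall m, residue x m = residue y m) -> x = y.
Proof.
case: x => x Px; case: y => y Py /= e.
have exy : x = y by exact: functional_extensionality_dep.
by subst y; congr Padic; exact: Prop_irrelevance.
Qed.

HB.instance Definition _ := gen_eqMixin padic.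
HB.instance Definition _ := gen_choiceMixin padic.

Lemma padic_int_coherent (z : int) : padic_coherent (fun m => z%:~R).
Proof. by move=> m; exists z. Qed.

Lemma padic_opp_coherent (x : padic) : padic_coherent (fun m => - residue x m).
Proof.
move=> m; have [z hz] := padicP x m; exists (- z) => i im.
by rewrite hz // mulrNz.
Qed.

Lemma padic_add_coherent (x y : padic) :
  padic_coherent (fun m => residue x m + residue y m).
Proof.
move=> m; have [z hz] := padicP x m; have [t ht] := padicP y m.
by exists (z + t) => i im; rewrite hz // ht // intrD.
Qed.

Lemma padic_mul_coherent (x y : padic) :
  padic_coherent (fun m => residue x m * residue y m).
Proof.
move=> m; have [z hz] := padicP x m; have [t ht] := padicP y m.
by exists (z * t) => i im; rewrite hz // ht // intrM.
Qed.

Definition padic_zero := Padic (padic_int_coherent 0).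
Definition padic_one := Padic (padic_int_coherent 1).
Definition padic_opp x := Padic (padic_opp_coherent x).
Definition padic_add x y := Padic (padic_add_coherent x y).
Definition padic_mul x y := Padic (padic_mul_coherent x y).

Lemma padic_addA : associative padic_add.
Proof. by move=> x y z; apply: padic_ext => m /=; rewrite addrA. Qed.
Lemma padic_addC : commutative padic_add.
Proof. by move=> x y; apply: padic_ext => m /=; rewrite addrC. Qed.
Lemma padic_add0 : left_id padic_zero padic_add.
Proof. by move=> x; apply: padic_ext => m /=; rewrite add0r. Qed.
Lemma padic_addN : left_inverse padic_zero padic_opp padic_add.
Proof. by move=> x; apply: padic_ext => m /=; rewrite addNr. Qed.

HB.instance Definition _ :=
  GRing.isZmodule.Build padic padic_addA padic_addC padic_add0 padic_addN.

Lemma padic_mulA : associative padic_mul.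
Proof. by move=> x y z; apply: padic_ext => m /=; rewrite mulrA. Qed.
Lemma padic_mulC : commutative padic_mul.
Proof. by move=> x y; apply: padic_ext => m /=; rewrite mulrC. Qed.
Lemma padic_mul1 : left_id padic_one padic_mul.
Proof. by move=> x; apply: padic_ext => m /=; rewrite mul1r. Qed.
Lemma padic_mulD : left_distributive padic_mul padic_add.
Proof. by move=> x y z; apply: padic_ext => m /=; rewrite mulrDl. Qed.
Lemma padic_one_neq0 : padic_one != padic_zero.
Proof.
apply/eqP => /(congr1 (fun x => residue x 0)) /=.
by move/eqP; rewrite oner_eq0.
Qed.

HB.instance Definition _ := GRing.Zmodule_isComNzRing.Build padic
  padic_mulA padic_mulC padic_mul1 padic_mulD padic_one_neq0.

Definition padic_dvd (m : nat) (x : padic) : Prop :=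
  exists y : padic, x = (p ^ m)%:R * y.

End Padic.

Section QuadraticOrder.
Variable n : nat.

Definition Delta : int := 1 - 24%:Z * n%:Z.

Definition sqrtDelta : algC := sqrtC Delta%:~R.

Definition omega : algC := (Delta%:~R + sqrtDelta) / 2%:R.

(* The order of discriminant Delta, as the subring Z + Z omega of the complex
   numbers; this fixes the embedding of the quadratic field in C. *)
Definition quad_pred : pred algC :=
  fun z => `[< exists a b : int, z = a%:~R + b%:~R * omega >].

Lemma omega_sqr :
  omega ^+ 2 = Delta%:~R * omega - (6%:Z * n%:Z * (24%:Z * n%:Z - 1))%:~R.
Proof.
have hs : sqrtDelta ^+ 2 = Delta%:~R by rewrite sqrtCK.
have hD : (Delta%:~R : algC) = 1 - 24%:R * n%:R.
  by rewrite /Delta intrB intrM.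
have -> : ((6%:Z * n%:Z * (24%:Z * n%:Z - 1))%:~R : algC)
          = 6%:R * n%:R * (24%:R * n%:R - 1).
  by rewrite !intrM intrB intrM.
rewrite /omega expr_div_n sqrrD hs hD.
by field.
Qed.

Fact quad_subring : subring_closed quad_pred.
Proof.
split.
- by apply/asboolP; exists 1, 0; rewrite mul0r addr0.
- move=> x y /asboolP[a [b ->]] /asboolP[c [d ->]]; apply/asboolP.
  exists (a - c), (b - d); rewrite !intrB; ring.
- move=> x y /asboolP[a [b ->]] /asboolP[c [d ->]]; apply/asboolP.
  exists (a * c - b * d * (6%:Z * n%:Z * (24%:Z * n%:Z - 1))),
         (a * d + b * c + b * d * Delta).
  rewrite intrB !intrD !(intrM _ (b * d)) !intrM.
  have := omega_sqr; rewrite !intrM => h.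
  transitivity (a%:~R * c%:~R + (a%:~R * d%:~R + b%:~R * c%:~R) * omega
                + b%:~R * d%:~R * omega ^+ 2); first by ring.
  by rewrite h; ring.
Qed.

HB.instance Definition _ := GRing.isSubringClosed.Build algC quad_pred
  quad_subring.

Record quad_order := QuadOrder { quad_val : algC; _ : quad_val \in quad_pred }.

HB.instance Definition _ := [isSub for quad_val].
HB.instance Definition _ := [Choice of quad_order by <:].
HB.instance Definition _ := [SubChoice_isSubComNzRing of quad_order by <:].

Definition quad_field : set algC :=
  [set z | exists a b : rat, z = ratr a + ratr b * sqrtDelta].

Definition quad_integers : set algC := quad_field `&` [set z | z \in Aint].

Definition prime_ideal_above (l : nat) (I : set algC) : Prop :=
  [/\ I `<=` quad_integers,
      I l%:R /\ ~ I 1,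
      forall x y, I x -> I y -> I (x + y),
      forall x y, quad_integers x -> I y -> I (x * y)
    & forall x y, quad_integers x -> quad_integers y -> I (x * y) ->
        I x \/ I y].

Definition split_in_quad_field (l : nat) : Prop :=
  exists I J, [/\ prime_ideal_above l I, prime_ideal_above l J & I <> J].

End QuadraticOrder.

Section Embeddings.
Variables (F : fieldType) (E : ell_curve F) (C : set (ec_point E)) (n : nat).

Notation endo := (ec_point E -> ec_point E).
Notation O := (quad_order n).
Notation R := (ec_End_level C).

Definition is_embedding (iota : O -> endo) : Prop :=
  [/\ forall x, R (iota x),
      iota 1 = id,
      forall x y, iota (x + y) = ec_addf (iota x) (iota y),
      forall x y, iota (x * y) = iota x \o iota y
    & injective iota].

(* The elements of End(E) that lie in iota(K) inside End(E) (x) Q: elements of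
   K are the x / m with x in O and m > 0, and phi = iota(x) / m holds in
   End(E) (x) Q iff m phi = iota(x), since End(E) is torsion free. *)
Definition image_of_K (iota : O -> endo) : set endo :=
  [set phi | exists m x, (0 < m)%N /\ ec_mulf m phi = iota x].

Definition is_optimal (iota : O -> endo) : Prop :=
  image_of_K iota `&` R = range iota.

(* [theta] induces a ring isomorphism from End(E) (x) Z_p, the inverse limit of
   the End(E)/p^m, to the ring of 2 x 2 matrices over Z_p, which carries the
   stabilizer of C[p^v], v = v_p(6), to the matrices that are upper triangular
   modulo p^v. *)
Definition local_identification (p : nat) (theta : endo -> 'M[padic p]_2)
  : Prop :=
  [/\ theta id = 1%:M,
      forall phi psi, ec_End phi -> ec_End psi ->
        theta (ec_addf phi psi) = theta phi + theta psi /\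
        theta (phi \o psi) = theta phi *m theta psi,
      forall m phi, ec_End phi -> (forall i j, padic_dvd m (theta phi i j)) ->
        exists2 psi, ec_End psi & phi = ec_mulf (p ^ m) psi,
      forall m (M : 'M[padic p]_2), exists2 phi, ec_End phi &
        forall i j, padic_dvd m (theta phi i j - M i j)
    & forall phi, ec_End phi ->
        (forall P, C P -> ec_mul (p ^ logn p 6) P = ec_zero E -> C (phi P)) <->
        padic_dvd (logn p 6) (theta phi ord_max ord0)].

(* As Delta = 1 (mod 24), both primes p | 6 split in K, and the structural map
   O -> O (x) Z_p -> Z_p is one of the two ring homomorphisms O -> Z_p. *)
Definition is_structural_map (p : nat) (s : O -> padic p) : Prop :=
  [/\ s 1 = 1, forall x y, s (x + y) = s x + s y
    & forall x y, s (x * y) = s x * s y].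

(* On matrices that are upper triangular modulo p^v the (1,1)-entry is a ring
   homomorphism modulo p^v only, so this is where it is compared with the
   structural map O -> Z_p. *)
Definition is_oriented (theta : forall p : nat, endo -> 'M[padic p]_2)
    (str : forall p : nat, O -> padic p) (iota : O -> endo) : Prop :=
  forall p, prime p -> (p %| 6)%N -> forall x,
    padic_dvd (logn p 6) (theta p (iota x) ord0 ord0 - str p x).

Definition oriented_optimal theta str : set (O -> endo) :=
  [set iota | [/\ is_embedding iota, is_optimal iota
                & is_oriented theta str iota]].

Definition unit_conjugate (iota iota' : O -> endo) : Prop :=
  exists u v : endo, [/\ R u, R v, u \o v = id, v \o u = id
    & forall x, iota' x = u \o iota x \o v].

Definition embedding_classes theta str : set (set (O -> endo)) :=
  [set [set iota' | oriented_optimal theta str iota' /\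
                    unit_conjugate iota iota']
  | iota in oriented_optimal theta str].

(* The local orientations recorded at l: l of them when l is nonsplit in K,
   otherwise nothing is recorded. *)
Definition local_orientations (l : nat) : set nat :=
  [set i | (split_in_quad_field n l /\ (i < 1)%N) \/
           (~ split_in_quad_field n l /\ (i < l)%N)].

(* h is the number of oriented optimal embeddings up to conjugacy; this
   includes the finiteness of the set that is counted. *)
Definition embedding_number (l : nat) theta str (h : nat) : Prop :=
  ((embedding_classes theta str `*` local_orientations l) #= `I_h)%card.

End Embeddings.

(* Main.v *)
Require Import Defs.
From HB Require Import structures.
From mathcomp Require Import all_boot all_order all_algebra all_field.
From mathcomp Require Import ring zify.
From mathcomp Require Import boolp classical_sets functions cardinality.

Set Implicit Arguments.
Unset Strict Implicit.
Unset Printing Implicit Defensive.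

Import Order.TTheory GRing.Theory Num.Theory.
Local Open Scope classical_set_scope.
Local Open Scope ring_scope.

(* No oriented optimal embedding exists, so the number counted is 0.  Let iota
   be an embedding of the order O of discriminant Delta = m l^2, and let phi be
   the image of sqrt(Delta), so that phi phi = [m] [l] [l].  On abscissas an
   endomorphism acts by a rational function of x, which factors uniquely as a
   separable function after a power of Frobenius.  As E is supersingular, [l]
   is injective on points, hence acts as a Moebius map after the q-th power
   map for some power q of l.  A composite of separable functions is separable,
   so phi phi = [m] [l] [l] forces phi to factor through the q-th power map
   too.  Therefore psi = [l]^-1 phi is again an endomorphism preserving C, which
   lies in iota(K) but not in iota(O) because sqrt(Delta) / l is not in O.

   Associativity of the chord-tangent law is never used: whatever is needed
   about multiples of points follows from iota being a ring homomorphism, and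
   translations are only used at generic points, where
   (P + Q) - Q = P is a direct computation. *)

Ltac horner_simpl :=
  rewrite ?(hornerD, hornerN, hornerM, hornerZ, hornerC, hornerX, horner_exp).

(** * Rational functions of one variable, evaluated pointwise *)

Section RationalFunctions.
Variable F : closedFieldType.
Implicit Types (p q U W B : {poly F}) (x y z t : F).

Lemma exists_nonroot p : p != 0 -> exists x, p.[x] != 0.
Proof. by move=> /closed_nonrootP[x]; exists x. Qed.

Lemma poly_eq_generic B p q :
  B != 0 -> (forall x, B.[x] != 0 -> p.[x] = q.[x]) -> p = q.
Proof.
move=> B0 h; apply/eqP; rewrite -subr_eq0; apply: contraT => pq0.
have /exists_nonroot[x] : (p - q) * B != 0 by rewrite mulf_neq0.
rewrite hornerM mulf_eq0 negb_or => /andP[d Bx].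
by move: d; rewrite hornerD hornerN h // subrr eqxx.
Qed.

Lemma exists_root_exp (m : nat) x : (0 < m)%N -> exists y, y ^+ m = x.
Proof.
move=> m0; have [y hy] := solve_monicpoly (fun i => if i == 0%N then x else 0) m0.
exists y; rewrite hy; case: m m0 {hy} => // m _.
rewrite big_ord_recl /= expr0 mulr1 big1 ?addr0 // => i _.
by rewrite /= mul0r.
Qed.

(** A value rather than an element of a fraction field: where [W] vanishes it defaults to 0, hence
    the conditions [W.[x] != 0] below. *)
Definition ratfun U W x := U.[x] / W.[x].

Definition nonconstant U W := W != 0 /\ forall t, U != t *: W.

(** The numerator of the derivative of [U / W]; its nonvanishing expresses separability. *)
Definition wronskian U W := U^`() * W - U * W^`().

Lemma wronskian_nonconstant U W : wronskian U W != 0 -> nonconstant U W.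
Proof.
move=> w; split=> [|t]; apply: contraNneq w => ->.
  by rewrite /wronskian deriv0 !mulr0 subrr.
by rewrite /wronskian derivZ -scalerAl -scalerAl mulrC subrr.
Qed.

(** A root [b] of [B] is a value of [U / W] only at roots of [U - b W], which is a nonzero
    polynomial by nonconstancy. *)
Lemma nonconstant_avoid U W B : nonconstant U W -> B != 0 ->
  exists2 B', B' != 0 &
    forall x, B'.[x] != 0 -> W.[x] != 0 /\ B.[ratfun U W x] != 0.
Proof.
move=> [W0 nc] B0; have [rs eB] := closed_field_poly_normal B.
exists (W * \prod_(b <- rs) (U - b *: W)).
  rewrite mulf_neq0 // prodf_seq_neq0; apply/allP => b _ /=.
  by rewrite subr_eq0.
move=> x; rewrite hornerM mulf_eq0 negb_or => /andP[Wx h]; split => //.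
rewrite eB hornerZ mulf_neq0 ?lead_coef_eq0 // horner_prod.
rewrite horner_prod in h.
move: h; rewrite !prodf_seq_neq0 => /allP h; apply/allP => b brs.
have := h b brs; rewrite /= !hornerE; apply: contraNN.
by rewrite subr_eq0 /ratfun => /eqP <-; rewrite divfK // subrr.
Qed.

(** Horner's scheme with denominators cleared at each step; [d] need not be the degree of [p]. *)
Lemma homogenize U W p : exists H (d : nat),
  forall x, W.[x] != 0 -> H.[x] = W.[x] ^+ d * p.[ratfun U W x].
Proof.
elim/poly_ind: p => [|p c [H [d IH]]].
  by exists 0, 0%N => x _; rewrite !horner0 mulr0.
exists (H * U + c *: W ^+ d.+1), d.+1 => x Wx.
have es : U.[x] = ratfun U W x * W.[x] by rewrite /ratfun divfK.
horner_simpl; rewrite IH // es exprS.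
by ring.
Qed.

Lemma ratfun_comp U W U2 W2 : W != 0 -> nonconstant U2 W2 ->
  exists U3 W3 B, B != 0 /\ forall x, B.[x] != 0 ->
    W3.[x] != 0 /\ ratfun U W (ratfun U2 W2 x) = ratfun U3 W3 x.
Proof.
move=> W0 nc; have [B B0 hB] := nonconstant_avoid nc W0.
have [H1 [d1 h1]] := homogenize U2 W2 U.
have [H2 [d2 h2]] := homogenize U2 W2 W.
(* The exponents [d1] and [d2] may differ, so each polynomial receives the other's power of [W2]. *)
exists (H1 * W2 ^+ d2), (H2 * W2 ^+ d1), B; split=> // x /hB[W2x Wx].
rewrite /ratfun !hornerM !horner_exp h1 // h2 //.
have n1 : W2.[x] ^+ d1 != 0 by rewrite expf_neq0.
have n2 : W2.[x] ^+ d2 != 0 by rewrite expf_neq0.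
by split; [rewrite !mulf_neq0 | field; rewrite Wx n1 n2].
Qed.

(* At a generic point both sides take the same value [t]; the left-hand side
   minus [t] vanishes there to order one, the right-hand side minus [t] has
   derivative zero. *)
Lemma separable_comp U1 W1 U2 W2 A D B :
  wronskian U1 W1 != 0 -> wronskian U2 W2 != 0 ->
  A^`() = 0 -> D^`() = 0 -> D != 0 -> B != 0 ->
  (forall z, B.[z] != 0 ->
     ratfun U1 W1 (ratfun U2 W2 z) = ratfun A D z) -> False.
Proof.
move=> w1 w2 dA dD D0 B0 h.
have [W10 _] := wronskian_nonconstant w1.
have nc2 := wronskian_nonconstant w2.
have [B1 B10 hB1] := nonconstant_avoid nc2 (mulf_neq0 W10 w1).
have /exists_nonroot[z0] : B * B1 * D * wronskian U2 W2 != 0 by rewrite !mulf_neq0.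
rewrite !hornerM !mulf_eq0 !negb_or -!andbA => /and4P[Bz B1z Dz wz].
have [W2z] := hB1 _ B1z; rewrite hornerM mulf_eq0 negb_or => /andP[W1r w1r].
set r := ratfun U2 W2 z0 in W1r w1r *.
set t := ratfun U1 W1 r.
have tE : t = A.[z0] / D.[z0] by rewrite /t h.
set G := U1 - t *: W1.
have Gr : root G r by rewrite /root !hornerE /t /ratfun divfK // subrr.
have [G1 eG] := factor_theorem _ _ Gr.
(* Otherwise [r] is a double root of [U1 - t W1], and the wronskian vanishes there. *)
have G1r : G1.[r] != 0.
  apply: contraNneq w1r => G1r.
  have : G^`().[r] = 0 by rewrite eG derivM derivXsubC mulr1 hornerD hornerM hornerXsubC subrr mulr0 add0r.
  rewrite /G derivB derivZ !hornerE /wronskian => /eqP; rewrite subr_eq0 => /eqP e.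
  rewrite e /t /ratfun; apply/eqP; by field.
have [H1 [d1 h1]] := homogenize U2 W2 G1.
have [H2 [d2 h2]] := homogenize U2 W2 W1.
(* This is [(s - r) G1(s) / W1(s) = A / D - t] for [s = U2 / W2], with denominators cleared. *)
have E : (U2 - r *: W2) * (H1 * W2 ^+ d2 * D) = (A - t *: D) * (H2 * W2 ^+ d1.+1).
  apply: (@poly_eq_generic (B * B1 * D)); first by rewrite !mulf_neq0.
  move=> z; rewrite !hornerM !mulf_eq0 !negb_or -!andbA => /and3P[Bz' B1z' Dz'].
  have [W2z'] := hB1 _ B1z'; rewrite hornerM mulf_eq0 negb_or => /andP[W1r' _].
  horner_simpl; rewrite h1 // h2 //; set s := ratfun U2 W2 z in W1r' *.
  have es : U2.[z] = s * W2.[z] by rewrite /s /ratfun divfK.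
  have eA : A.[z] = U1.[s] / W1.[s] * D.[z] by rewrite -[_ / _]/(ratfun U1 W1 s) h // /ratfun divfK.
  have eU : U1.[s] = t * W1.[s] + G1.[s] * (s - r).
    have := congr1 (fun p => p.[s]) eG; rewrite /G !hornerE => <-; by ring.
  rewrite es eA eU exprS; by field.
(* At [z0] the right side has derivative 0, the left side [(U2 - r W2)'(z0)] times a nonzero
   value. *)
have := congr1 (fun p => p^`().[z0]) E.
have dAD : (A - t *: D)^`() = 0 by rewrite derivB derivZ dA dD scaler0 subrr.
rewrite derivM [in RHS]derivM dAD mul0r add0r.
have e1 : (U2 - r *: W2).[z0] = 0 by rewrite !hornerE /r /ratfun divfK // subrr.
have e2 : (A - t *: D).[z0] = 0 by rewrite !hornerE tE divfK // subrr.
rewrite hornerD !(hornerM, e1, e2) !mul0r addr0; apply/eqP.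
rewrite !horner_exp h1 // !mulf_neq0 ?expf_neq0 //.
apply: contraNneq wz; rewrite /wronskian !hornerE derivB derivZ !hornerE => /eqP.
rewrite subr_eq0 => /eqP ->; rewrite /r /ratfun; apply/eqP; by field.
Qed.

End RationalFunctions.

(** * Powers of Frobenius and separable factorization *)

Section Frobenius.
Variables (F : closedFieldType) (l : nat).
Hypothesis charFl : l \in [pchar F].
Implicit Types (p q U W B : {poly F}) (x y z t : F).

Let l_prime : prime l. Proof. exact: pcharf_prime charFl. Qed.

Lemma pchar_exp_gt0 (e : nat) : (0 < l ^ e)%N.
Proof. by rewrite expn_gt0 prime_gt0. Qed.

Lemma exprD_pchar_exp (e : nat) x y :
  (x + y) ^+ (l ^ e) = x ^+ (l ^ e) + y ^+ (l ^ e).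
Proof.
apply: exprDn_pchar; rewrite pnatX; apply/orP; left.
by rewrite pnatE.
Qed.

Lemma expr_pchar_inj (e : nat) : injective (fun x : F => x ^+ (l ^ e)).
Proof.
move=> x y /= h; apply/eqP; rewrite -subr_eq0.
have := exprD_pchar_exp e (x - y) y; rewrite subrK h => /eqP.
rewrite -subr_eq subrr eq_sym expf_eq0 pchar_exp_gt0 //.
Qed.

(** The coefficients of [p] are raised to the power [l ^ e]; the clause on derivatives serves to
    transport wronskians. *)
Lemma frobenius_twist (e : nat) p : exists p', forall x,
  p'.[x ^+ (l ^ e)] = p.[x] ^+ (l ^ e) /\
  p'^`().[x ^+ (l ^ e)] = p^`().[x] ^+ (l ^ e).
Proof.
have q0 : (l ^ e)%N != 0%N by rewrite -lt0n pchar_exp_gt0.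
elim/poly_ind: p => [|p c [p' IH]].
  by exists 0 => x; rewrite !derivE !horner0 expr0n (negbTE q0).
exists (p' * 'X + (c ^+ (l ^ e))%:P) => x; have [h1 h2] := IH x.
rewrite !derivE !hornerE !exprD_pchar_exp !exprMn h1 h2.
by split.
Qed.

(** Here the coefficients are replaced by [l ^ e]-th roots, which exist in a closed field. *)
Lemma frobenius_untwist (e : nat) p : exists p', forall x,
  p.[x ^+ (l ^ e)] = p'.[x] ^+ (l ^ e).
Proof.
elim/poly_ind: p => [|p c [p' IH]].
  exists 0 => x; rewrite !horner0 expr0n.
  by have := pchar_exp_gt0 e; case: (l ^ e)%N.
have [d hd] := exists_root_exp c (pchar_exp_gt0 e).
exists (p' * 'X + d%:P) => x.
by rewrite !hornerE exprD_pchar_exp exprMn IH hd.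
Qed.

Lemma horner_compXn (m : nat) p x : (p \Po 'X^m).[x] = p.[x ^+ m].
Proof. by rewrite horner_comp hornerXn. Qed.

(** From [i p_i = 0], only exponents divisible by [l] survive. The crude size bound, a consequence
    of [l >= 2], drives the descent in [frobenius_factor]. *)
Lemma deriv_eq0_compXn p : p^`() = 0 ->
  exists2 p1, p = p1 \Po 'X^l & (size p1 <= (size p).+1 %/ 2)%N.
Proof.
move=> dp; have l1 := prime_gt1 l_prime.
have cf i : ~~ (l %| i)%N -> p`_i = 0.
  case: i => [|i]; first by rewrite dvdn0.
  move=> li; have := congr1 (fun q => q`_i) dp.
  rewrite coef_deriv coef0 -mulr_natr => /eqP; rewrite mulf_eq0.
  by rewrite -(dvdn_pcharf charFl) (negbTE li) orbF => /eqP.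
exists (\poly_(i < (size p).+1 %/ 2) p`_(i * l)); last exact: size_poly.
apply/polyP => i; rewrite coef_comp_poly_Xn ?prime_gt0 //.
case: ifPn => [li|/cf //].
rewrite coef_poly divnK //; case: ltnP => // h.
rewrite nth_default //; move/dvdnP: li h => [j ->]; rewrite mulnK ?prime_gt0 //.
move=> h; have : (j * 2 <= j * l)%N by rewrite leq_mul2l l1 orbT.
by apply: leq_trans; move: h; set s := size p; lia.
Qed.

Lemma nonconstant_compXn (m : nat) U W : (0 < m)%N ->
  nonconstant (U \Po 'X^m) (W \Po 'X^m) -> nonconstant U W.
Proof.
move=> m0 [W0 h]; split=> [|t]; first by apply: contraNneq W0 => ->; rewrite comp_poly0.
by apply: contraNneq (h t) => ->; rewrite comp_polyZ.
Qed.

Lemma coprimep_compXn (m : nat) U W : (0 < m)%N ->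
  coprimep (U \Po 'X^m) (W \Po 'X^m) -> coprimep U W.
Proof.
move=> m0 /coprimep_root h; apply: Pdiv.ClosedField.root_coprimep => x.
have [y <-] := exists_root_exp x m0.
rewrite /root -!horner_compXn; exact: h.
Qed.

(** [U' W = U W'] and coprimality make [U] divide [U'], whose degree is smaller unless it is zero;
    likewise for [W]. *)
Lemma wronskian_eq0_coprime U W : coprimep U W -> wronskian U W = 0 ->
  U^`() = 0 /\ W^`() = 0.
Proof.
move=> cUW /eqP; rewrite subr_eq0 => /eqP e.
have aux p q : coprimep p q -> p^`() * q = p * q^`() -> p^`() = 0.
  move=> cpq epq; have : p %| p^`() * q by rewrite epq dvdp_mulr.
  rewrite Gauss_dvdpl // => dv; apply/eqP; apply: contraT => d0.
  have p0 : p != 0 by apply: contraNneq d0 => ->; rewrite derivE.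
  by have := dvdp_leq d0 dv; rewrite leqNgt lt_size_deriv.
by split; [exact: aux e | apply: (aux _ U); rewrite 1?coprimep_sym // mulrC -e mulrC].
Qed.

(** As long as the wronskian vanishes, [U] and [W] are both polynomials in [X^l]; the descent is on
    the sum of their sizes. *)
Lemma frobenius_factor U W : coprimep U W -> nonconstant U W ->
  exists e U1 W1, [/\ U = U1 \Po 'X^(l ^ e), W = W1 \Po 'X^(l ^ e),
    coprimep U1 W1 & wronskian U1 W1 != 0].
Proof.
have [m] := ubnP (size U + size W)%N; elim: m U W => // m IH U W.
rewrite ltnS => sm cUW nc; have [w|w] := eqVneq (wronskian U W) 0; last first.
  by exists 0%N, U, W; rewrite expn0 expr1 !comp_polyXr.
have [dU dW] := wronskian_eq0_coprime cUW w.
have [U1 eU sU] := deriv_eq0_compXn dU; have [W1 eW sW] := deriv_eq0_compXn dW.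
have l0 := prime_gt0 l_prime.
have nc1 : nonconstant U1 W1 by apply: (@nonconstant_compXn l); rewrite -?eU -?eW.
have c1 : coprimep U1 W1 by apply: (@coprimep_compXn l); rewrite -?eU -?eW.
(* The sizes drop strictly unless both polynomials are constant, which nonconstancy forbids. *)
have [big|] := boolP ((1 < size U) || (1 < size W))%N; last first.
  rewrite negb_or -!leqNgt => /andP[s1 s2]; case: nc => W0 /(_ (U`_0 / W`_0)).
  move/size1_polyC: s1 => s1; move/size1_polyC: s2 => s2.
  rewrite s2 polyC_eq0 in W0; rewrite s1 s2 !coefC /= -mul_polyC -polyCM divfK //.
  by rewrite eqxx.
have lt : (size U1 + size W1 < m)%N.
  move: big sm sU sW; set a := size U; set b := size W.
  by move: (size U1) (size W1); lia.
have [e [U2 [W2 [e1 e2 c2 w2]]]] := IH _ _ lt c1 nc1.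
exists e.+1, U2, W2; split=> //.
  by rewrite eU e1 -comp_polyA comp_Xn_poly -exprM -expnS.
by rewrite eW e2 -comp_polyA comp_Xn_poly -exprM -expnS.
Qed.

Lemma size_of_simple_root G z : root G z -> G^`().[z] != 0 ->
  (forall x, root G x -> x = z) -> (size G <= 2)%N.
Proof.
move=> Gz dG h; have [G1 eG] := factor_theorem _ _ Gz.
have G1z : G1.[z] != 0.
  by move: dG; rewrite eG derivM derivXsubC mulr1 hornerD hornerM hornerXsubC subrr mulr0 add0r.
have : size G1 == 1%N.
  apply: contraT => /closed_rootP[x rx]; have xz : x = z.
    by apply: h; rewrite eG rootM rx.
  by move: rx; rewrite xz /root (negbTE G1z).
by move=> /eqP s1; rewrite eG; apply: leq_trans (size_polyMleq _ _) _; rewrite s1 size_XsubC.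
Qed.

(** The fibre through a generic [z] is cut out by [U - t W], whose root [z] is simple and unique, so
    this polynomial has degree at most 1. Two distinct values of [t] then bound [U] and [W]: the map
    is a Moebius map. *)
Lemma injective_ratfun_size U W B :
  coprimep U W -> wronskian U W != 0 -> B != 0 ->
  (forall x y, B.[x] != 0 -> B.[y] != 0 ->
     ratfun U W x = ratfun U W y -> x = y) ->
  (size U <= 2)%N /\ (size W <= 2)%N.
Proof.
move=> cUW w B0 inj; have [W0 nc] := wronskian_nonconstant w.
have [rs eB] := closed_field_poly_normal (B * W).
have BW0 : B * W != 0 by rewrite mulf_neq0.
(* The last product keeps the value at [z] apart from the values at the roots [b] of [B W], where
   injectivity is not assumed. *)
pose B1 := B * W * wronskian U W * \prod_(b <- rs) (U.[b] *: W - W.[b] *: U).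
have B10 : B1 != 0.
  rewrite !mulf_neq0 // prodf_seq_neq0; apply/allP => b _ /=.
  rewrite subr_eq0; have [e|Wb] := eqVneq W.[b] 0.
    rewrite e scale0r scaler_eq0 (negbTE W0) orbF.
    by apply: contra_eqN e => Ub; apply: (coprimep_root cUW).
  apply: contra (nc (U.[b] / W.[b])) => /eqP e.
  by rewrite mulrC -scalerA e scalerA mulVf // scale1r.
have key z : B1.[z] != 0 -> (size (U - ratfun U W z *: W)%R <= 2)%N.
  rewrite !hornerM !mulf_eq0 !negb_or -!andbA => /and4P[Bz Wz wz hz].
  apply: (@size_of_simple_root _ z).
  - by rewrite /root !hornerE /ratfun divfK // subrr.
  - rewrite derivB derivZ !hornerE; apply: contra wz; rewrite subr_eq0 => /eqP e.
    by rewrite !hornerE e /ratfun; apply/eqP; field.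
  move=> x; rewrite /root !hornerE subr_eq0 => /eqP Ux.
  have [BWx|] := eqVneq (B * W).[x] 0; last first.
    rewrite hornerM mulf_eq0 negb_or => /andP[Bx Wx].
    by apply: inj => //; rewrite {1}/ratfun Ux mulfK.
  have xrs : x \in rs.
    move: BWx; rewrite eB hornerZ => /eqP; rewrite mulf_eq0 lead_coef_eq0 (negbTE BW0) /=.
    by rewrite -[_ == 0]/(root _ x) root_prod_XsubC.
  move: hz; rewrite horner_prod prodf_seq_neq0 => /allP/(_ x xrs) /=.
  by rewrite !hornerE Ux /ratfun => /eqP[]; field.
have [z1 h1] := exists_nonroot B10.
have /exists_nonroot[z2] : B1 * ('X - z1%:P) != 0 by rewrite mulf_neq0 // polyXsubC_eq0.
rewrite hornerM mulf_eq0 negb_or => /andP[h2]; rewrite !hornerE subr_eq0 => z21.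
have bz z : B1.[z] != 0 -> B.[z] != 0.
  by apply: contraNN; rewrite !hornerM => /eqP ->; rewrite !mul0r.
have t21 : ratfun U W z2 - ratfun U W z1 != 0.
  by rewrite subr_eq0; apply: contraNneq z21 => /(inj _ _ (bz _ h2) (bz _ h1)) ->.
have s1 := key _ h1; have s2 := key _ h2.
have sW : (size W <= 2)%N.
  rewrite -(size_scale _ t21).
  have -> : (ratfun U W z2 - ratfun U W z1) *: W =
    (U - ratfun U W z1 *: W) - (U - ratfun U W z2 *: W).
    by rewrite scalerBl; ring.
  by apply: leq_trans (size_polyD _ _) _; rewrite size_polyN geq_max s1 s2.
split=> //; rewrite -[U](subrK (ratfun U W z1 *: W)).
apply: leq_trans (size_polyD _ _) _; rewrite geq_max s1 /=.
exact: leq_trans (size_scale_leq _ _) sW.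
Qed.

End Frobenius.

(** * The chord-tangent law at generic points, and endomorphisms in coordinates *)

Section CurveMaps.
Variables (F : closedFieldType) (E : ell_curve F).
Hypothesis two_neq0 : (2%:R : F) != 0.
Implicit Types (P Q : ec_point E) (U W V T B p : {poly F}) (x y t : F).
Implicit Types phi : ec_point E -> ec_point E.

(** Locked so that Horner rewriting leaves it whole. *)
Definition cubic : {poly F} := locked ('X^3 + ecA E *: 'X + (ecB E)%:P).

Lemma cubicE x : cubic.[x] = x ^+ 3 + ecA E * x + ecB E.
Proof. by rewrite /cubic -lock; horner_simpl. Qed.

Lemma size_cubic : size cubic = 4%N.
Proof.
rewrite /cubic -lock -addrA size_polyDl size_polyXn //.
apply: leq_ltn_trans (size_polyD _ _) _; rewrite gtn_max size_polyC.
rewrite (leq_ltn_trans (size_scale_leq _ _)) ?size_polyX //=.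
by case: (_ != 0).
Qed.

Lemma cubic_neq0 : cubic != 0.
Proof. by rewrite -size_poly_eq0 size_cubic. Qed.

Lemma curve_eq P x y : ec_coord P = Some (x, y) -> y ^+ 2 = cubic.[x].
Proof. by case: P => p /= h e; rewrite e in h; rewrite cubicE; apply/eqP. Qed.

Lemma exists_point x y : y ^+ 2 = cubic.[x] -> exists P, ec_coord P = Some (x, y).
Proof.
move=> h; have on : on_curve E (Some (x, y)) by rewrite /= h cubicE.
by exists (ECPoint on).
Qed.

Lemma exists_point_above x : exists P y, ec_coord P = Some (x, y).
Proof.
have [y /exists_point[P hP]] := exists_root_exp cubic.[x] (ltn0Sn 1).
by exists P, y.
Qed.

Lemma ec_neg_on_curve P :
  on_curve E (omap (fun q => (q.1, - q.2)) (ec_coord P)).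
Proof. by case: P => -[[x y]|] //=; rewrite sqrrN. Qed.

Definition ec_neg P : ec_point E := ECPoint (ec_neg_on_curve P).

Lemma ec_coord_neg P x y :
  ec_coord P = Some (x, y) -> ec_coord (ec_neg P) = Some (x, - y).
Proof. by move=> /= ->. Qed.

Lemma ec_add0 P : ec_add P (ec_zero E) = P.
Proof. by apply: val_inj; case: P => -[[x y]|]. Qed.

Lemma ec_addN P : ec_add P (ec_neg P) = ec_zero E.
Proof.
by apply: val_inj; case: P => -[[x y]|] //= h; rewrite opprK !eqxx.
Qed.

Lemma ec_add_eq0 P Q : ec_add P Q = ec_zero E -> Q = ec_neg P.
Proof.
move=> /(congr1 (@ec_coord _ _)) h; apply: val_inj; move: h.
case: P => -[[x1 y1]|] hP; case: Q => -[[x2 y2]|] hQ //=.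
by case: ifP => // /andP[/eqP -> /eqP ->]; rewrite opprK.
Qed.

(** If [x(2P) = x(P)], the tangent formula gives [y(2P) = -y(P)]; then [2P = P] forces [y(P) = 0],
    in which case [2P] is at infinity. This stands in for cancellation. *)
Lemma ec_addP_eq P : ec_add P P = P -> P = ec_zero E.
Proof.
move=> /(congr1 (@ec_coord _ _)) h; apply: val_inj; move: h.
case: P => -[[x y]|] hP //=; case: ifP => // hn [e1 e2].
have /eqP : 2%:R * y = 0.
  by move: e2; rewrite e1 subrr mulr0 add0r => e2; rewrite mulr_natl mulr2n -{1}e2 addNr.
rewrite mulf_eq0 (negbTE two_neq0) /= => /eqP y0.
by rewrite y0 oppr0 !eqxx in hn.
Qed.

Lemma ec_same_x P Q x y y' : ec_coord P = Some (x, y) ->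
  ec_coord Q = Some (x, y') -> Q = P \/ Q = ec_neg P.
Proof.
move=> hP hQ; have : (y' - y) * (y' + y) == 0.
  by rewrite -subr_sqr (curve_eq hP) (curve_eq hQ) subrr.
rewrite mulf_eq0 subr_eq0 addr_eq0 => /orP[] /eqP e; [left|right]; apply: val_inj.
  by rewrite /= hP hQ e.
by rewrite /= hP hQ e.
Qed.

(* The norm of [g0 + y g1] from the function field of the curve to [F(x)]. *)
Lemma norm_neq0 (g0 g1 : {poly F}) :
  (g0 != 0) || (g1 != 0) -> g0 ^+ 2 - g1 ^+ 2 * cubic != 0.
Proof.
move=> h; rewrite subr_eq0; apply/eqP => e.
have [g10|g10] := eqVneq g1 0.
  by move: h e; rewrite g10 eqxx orbF expr0n mul0r => g00 /eqP; rewrite expf_eq0 (negbTE g00).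
have g00 : g0 != 0.
  apply: contraTneq isT => g00; move: e; rewrite g00 expr0n => /eqP.
  by rewrite eq_sym mulf_eq0 expf_eq0 (negbTE g10) (negbTE cubic_neq0).
(* The left side has even degree and the right side odd degree. *)
have := congr1 (fun p : {poly F} => size p) e.
rewrite !expr2 !size_mul ?mulf_neq0 ?cubic_neq0 // size_cubic.
by move: g00 g10; rewrite -!size_poly_gt0; move: (size g0) (size g1); lia.
Qed.

Lemma reduce_mod_curve (f : {poly {poly F}}) : exists g0 g1 : {poly F},
  forall x y, y ^+ 2 = cubic.[x] -> f.[y%:P].[x] = g0.[x] + y * g1.[x].
Proof.
elim/poly_ind: f => [|f c [g0 [g1 IH]]].
  by exists 0, 0 => x y _; rewrite !horner0 mulr0 addr0.
exists (c + g1 * cubic), g0 => x y h.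
rewrite hornerD hornerMX hornerC hornerD hornerM IH // hornerC.
horner_simpl; rewrite -h; by ring.
Qed.

Lemma exists_point_avoiding B : B != 0 ->
  exists P x y, ec_coord P = Some (x, y) /\ B.[x] != 0.
Proof.
move=> /exists_nonroot[x Bx]; have [P [y hP]] := exists_point_above x.
by exists P, x, y.
Qed.

Lemma ec_add_coordE P Q x1 y1 x2 y2 s : ec_coord P = Some (x1, y1) ->
  ec_coord Q = Some (x2, y2) -> x1 != x2 -> s = (y2 - y1) / (x2 - x1) ->
  ec_coord (ec_add P Q) =
    Some (s ^+ 2 - x1 - x2, s * (x1 - (s ^+ 2 - x1 - x2)) - y1).
Proof. by move=> /= -> ->; rewrite /= /ec_slope => /negbTE -> ->. Qed.

(* The translate by a generic [Q] avoids a given abscissa, because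
   [x(P + Q) = t] amounts to [A(x) = 2 y1 y]. *)
Lemma translate_avoid1 P x1 y1 t : ec_coord P = Some (x1, y1) ->
  exists2 B, B != 0 & forall Q x2 y2, ec_coord Q = Some (x2, y2) ->
    B.[x2] != 0 -> x1 != x2 /\
    forall x3 y3, ec_coord (ec_add P Q) = Some (x3, y3) -> x3 != t.
Proof.
move=> hP.
pose A : {poly F} := (x1 - t) *: 'X^2 + (ecA E + x1 ^+ 2 + 2%:R * x1 * t) *: 'X
  + (ecB E + y1 ^+ 2 - (t + x1) * x1 ^+ 2)%:P.
pose N := A ^+ 2 - ((2%:R * y1)%:P : {poly F}) ^+ 2 * cubic.
have N0 : N != 0.
  (* If both parts vanish, then [y1 = 0], [t = x1] and [x1] is a double root of the cubic, against
     smoothness. *)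
  apply: norm_neq0; rewrite -negb_and; apply/negP => /andP[/eqP A0].
  rewrite polyC_eq0 mulf_eq0 (negbTE two_neq0) /= => /eqP y10.
  have := congr1 (fun p : {poly F} => p`_2) A0; have := congr1 (fun p : {poly F} => p`_1) A0.
  rewrite !coef0 /A !coefD !coefZ !coefXn !coefX !coefC /= !mulr0 !mulr1 !addr0 add0r => e1 e2.
  have et : t = x1 by apply/eqP; rewrite eq_sym -subr_eq0 e2.
  have ea : ecA E = - 3%:R * x1 ^+ 2.
    by apply/eqP; rewrite -subr_eq0 -e1 et; apply/eqP; ring.
  have eb : ecB E = 2%:R * x1 ^+ 3.
    have := curve_eq hP; rewrite cubicE y10 ea expr0n /= => e0.
    apply/eqP; rewrite -subr_eq0; apply/eqP; rewrite [RHS]e0; by ring.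
  by have := ec_smooth E; rewrite ea eb => /eqP[]; ring.
exists (('X - x1%:P) * N); first by rewrite mulf_neq0 // polyXsubC_eq0.
move=> Q x2 y2 hQ; rewrite hornerM mulf_eq0 negb_or hornerXsubC subr_eq0 => /andP[x21 Nx].
have x12 : x1 != x2 by rewrite eq_sym.
split=> // x3 y3; rewrite (ec_add_coordE hP hQ x12 (erefl _)) => -[<- _].
apply: contraNneq Nx => e.
have d0 : x2 - x1 != 0 by rewrite subr_eq0.
have e' : (y2 - y1) ^+ 2 = (t + x1 + x2) * (x2 - x1) ^+ 2.
  rewrite -e; by field.
have AE : A.[x2] = 2%:R * y1 * y2.
  have h2 := curve_eq hQ; rewrite cubicE in h2.
  transitivity (y2 ^+ 2 + y1 ^+ 2 - (t + x1 + x2) * (x2 - x1) ^+ 2).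
    by rewrite h2 /A; horner_simpl; ring.
  by rewrite -e'; ring.
by rewrite /N hornerD hornerN horner_exp hornerM horner_exp hornerC AE -(curve_eq hQ); apply/eqP; ring.
Qed.

(** The points [P + Q], [-Q] and [-P] lie on the mirror image of the chord through [P] and [Q],
    whose slope is [-s]. Besides [x(P) = x(Q)], the coincidence [x(P + Q) = x(Q)] has to be
    avoided. *)
Lemma translate_back P x1 y1 : ec_coord P = Some (x1, y1) ->
  exists2 B, B != 0 & forall Q x2 y2, ec_coord Q = Some (x2, y2) ->
    B.[x2] != 0 -> ec_add (ec_add P Q) (ec_neg Q) = P.
Proof.
move=> hP.
(* On the curve, [x(P + Q) = x(Q)] yields [A(x2) = 2 y1 y2]; the leading coefficient of [A] is
   -1. *)
pose A : {poly F} := cubic + (y1 ^+ 2)%:P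
  - (x1%:P + 2%:R *: 'X) * ('X - x1%:P) ^+ 2.
have A0 : A != 0.
  apply/eqP => /(congr1 (fun p : {poly F} => p`_3)).
  have -> : A = - 'X^3 + ((3%:R * x1) *: 'X^2 + ecA E *: 'X + (ecB E + y1 ^+ 2 - x1 ^+ 3)%:P).
    rewrite /A /cubic -lock -!mul_polyC !(polyCD, polyCN, polyCM, polyC_exp); ring.
  rewrite !coef0 !coefD coefN !coefZ !coefXn !coefX !coefC /= !mulr0 !addr0 => /eqP.
  by rewrite oppr_eq0 oner_eq0.
pose N := A ^+ 2 - ((2%:R * y1)%:P : {poly F}) ^+ 2 * cubic.
have N0 : N != 0 by apply: norm_neq0; rewrite A0.
exists (('X - x1%:P) * N); first by rewrite mulf_neq0 // polyXsubC_eq0.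
move=> Q x2 y2 hQ; rewrite hornerM mulf_eq0 negb_or hornerXsubC subr_eq0 => /andP[x21 Nx].
have x12 : x1 != x2 by rewrite eq_sym.
have d0 : x2 - x1 != 0 by rewrite subr_eq0.
pose s := (y2 - y1) / (x2 - x1); pose x3 := s ^+ 2 - x1 - x2.
have h3 : ec_coord (ec_add P Q) = Some (x3, s * (x1 - x3) - y1).
  exact: ec_add_coordE hP hQ x12 (erefl _).
have sE : y2 = y1 + s * (x2 - x1) by rewrite /s divfK //; ring.
have x32 : x3 != x2.
  apply: contraNneq Nx => e.
  have e' : s ^+ 2 = x1 + 2%:R * x2 by rewrite -[s ^+ 2](subrK x1) -[_ - x1](subrK x2) -/x3 e; ring.
  have AE : A.[x2] = 2%:R * y1 * y2.
    have h2 := curve_eq hQ.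
    transitivity (y2 ^+ 2 + y1 ^+ 2 - s ^+ 2 * (x2 - x1) ^+ 2).
      by rewrite e' h2 /A; horner_simpl; ring.
    by rewrite sE; ring.
  by rewrite /N hornerD hornerN horner_exp hornerM horner_exp hornerC AE -(curve_eq hQ); apply/eqP; ring.
have d3 : x2 - x3 != 0 by rewrite subr_eq0 eq_sym.
have es : - s = (- y2 - (s * (x1 - x3) - y1)) / (x2 - x3) by rewrite sE; field.
have := ec_add_coordE h3 (ec_coord_neg hQ) x32 es => h4.
apply: val_inj; rewrite [LHS]h4 [RHS]hP.
have -> : (- s) ^+ 2 - x3 - x2 = x1 by rewrite /x3; ring.
by congr (Some (_, _)); ring.
Qed.

Lemma translate_avoid P x1 y1 B : ec_coord P = Some (x1, y1) -> B != 0 ->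
  exists2 B', B' != 0 & forall Q x2 y2, ec_coord Q = Some (x2, y2) ->
    B'.[x2] != 0 -> ec_add (ec_add P Q) (ec_neg Q) = P /\
    exists x3 y3, ec_coord (ec_add P Q) = Some (x3, y3) /\ B.[x3] != 0.
Proof.
move=> hP B0; have [rs eB] := closed_field_poly_normal B.
have [B1 B10 hB1] := translate_back hP.
have [B2 B20 hB2] : exists2 B2, B2 != 0 & forall Q x2 y2, ec_coord Q = Some (x2, y2) ->
    B2.[x2] != 0 -> x1 != x2 /\
    forall x3 y3, ec_coord (ec_add P Q) = Some (x3, y3) -> x3 \notin rs.
  elim: rs {eB} => [|t rs [B2 B20 IH]].
    (* The abscissa 0 is arbitrary: only [x1 != x2] is kept. *)
    have [B2 B20 h] := translate_avoid1 0 hP; exists B2 => // Q x2 y2 hQ Bx.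
    by have [] := h _ _ _ hQ Bx.
  have [B3 B30 h] := translate_avoid1 t hP.
  exists (B2 * B3); first by rewrite mulf_neq0.
  move=> Q x2 y2 hQ; rewrite hornerM mulf_eq0 negb_or => /andP[b2 b3].
  have [x12 h2] := IH _ _ _ hQ b2; have [_ h3] := h _ _ _ hQ b3.
  split=> // x3 y3 e; rewrite inE negb_or (h3 _ _ e) (h2 _ _ e) //.
exists (B1 * B2); first by rewrite mulf_neq0.
move=> Q x2 y2 hQ; rewrite hornerM mulf_eq0 negb_or => /andP[b1 b2].
split; first exact: hB1 hQ b1.
have [x12 h] := hB2 _ _ _ hQ b2.
pose s := (y2 - y1) / (x2 - x1); pose x3 := s ^+ 2 - x1 - x2.
have h3 : ec_coord (ec_add P Q) = Some (x3, s * (x1 - x3) - y1).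
  exact: ec_add_coordE hP hQ x12 (erefl _).
exists x3, (s * (x1 - x3) - y1); split=> //.
rewrite eB hornerZ mulf_neq0 ?lead_coef_eq0 //.
by rewrite -[_ == 0]/(root _ x3) root_prod_XsubC (h _ _ h3).
Qed.

Definition avoids B P := exists x y, ec_coord P = Some (x, y) /\ B.[x] != 0.

Lemma avoids_neg B P : avoids B P -> avoids B (ec_neg P).
Proof. by move=> [x [y [h b]]]; exists x, (- y); rewrite (ec_coord_neg h). Qed.

(** Extends facts about additive maps from generic points to all points. An affine [P] is
    [(P + Q) + (-Q)] for generic [Q], and infinity is [Q + (-Q)]. *)
Lemma sum_of_generic B P : B != 0 ->
  exists Q1 Q2, [/\ P = ec_add Q1 Q2, avoids B Q1 & avoids B Q2].
Proof.
move=> B0; case hP : (ec_coord P) => [[x1 y1]|].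
  have [B' B'0 h] := translate_avoid hP B0.
  have [Q [x2 [y2 [hQ]]]] := exists_point_avoiding (mulf_neq0 B0 B'0).
  rewrite hornerM mulf_eq0 negb_or => /andP[b b'].
  have [e [x3 [y3 [h3 b3]]]] := h _ _ _ hQ b'.
  exists (ec_add P Q), (ec_neg Q); split; [by [] | by exists x3, y3 |].
  by apply: avoids_neg; exists x2, y2.
have [Q [x2 [y2 [hQ b]]]] := exists_point_avoiding B0.
have aQ : avoids B Q by exists x2, y2.
exists Q, (ec_neg Q); split=> //; last exact: avoids_neg.
by rewrite ec_addN; apply: val_inj.
Qed.

Definition ec_additive phi := forall P Q, phi (ec_add P Q) = ec_add (phi P) (phi Q).

Lemma ec_additive0 phi : ec_additive phi -> phi (ec_zero E) = ec_zero E.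
Proof.
by move=> h; apply: ec_addP_eq; rewrite -h; congr phi; apply: val_inj.
Qed.

Lemma ec_additiveN phi P : ec_additive phi -> phi (ec_neg P) = ec_neg (phi P).
Proof.
by move=> h; apply: ec_add_eq0; rewrite -h ec_addN ec_additive0.
Qed.

Lemma ec_additive_eq0 phi B : ec_additive phi -> B != 0 ->
  (forall P, avoids B P -> phi P = ec_zero E) -> forall P, phi P = ec_zero E.
Proof.
move=> ha B0 h P; have [Q1 [Q2 [-> a1 a2]]] := sum_of_generic P B0.
by rewrite ha !h // ec_add0.
Qed.

(* For all but finitely many [x],
   [phi (x, y) = (U(x) / W(x), y V(x) / T(x))]. *)
Definition normal_form phi U W V T B : Prop :=
  [/\ coprimep U W, B != 0
    & forall P x y, ec_coord P = Some (x, y) -> B.[x] != 0 ->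
      [/\ W.[x] != 0, T.[x] != 0
        & ec_coord (phi P) = Some (ratfun U W x, y * ratfun V T x)]].

Lemma conj_nonzero (g0 g1 : {poly F}) P x y : ec_coord P = Some (x, y) ->
  (g0 ^+ 2 - g1 ^+ 2 * cubic).[x] != 0 -> g0.[x] + y * g1.[x] != 0.
Proof.
move=> hP; apply: contraNneq => e; horner_simpl; rewrite -(curve_eq hP).
apply/eqP; transitivity ((g0.[x] + y * g1.[x]) * (g0.[x] - y * g1.[x])); first by ring.
by rewrite e mul0r.
Qed.

(** An additive map commutes with negation, that is with [y -> -y]. Hence the abscissa of the image
    is even in [y], a function of [x] alone, and the ordinate is odd, [y] times such a function. *)
Lemma exists_normal_form phi : ec_End phi -> phi <> (fun=> ec_zero E) ->
  exists U W V T B, normal_form phi U W V T B.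
Proof.
move=> [ha [[[fX fY] fZ] [[P0 [x0 [y0 [hP0 nz]]]] hf]]] phi0.
have [X0 [X1 hX]] := reduce_mod_curve fX.
have [Y0 [Y1 hY]] := reduce_mod_curve fY.
have [Z0 [Z1 hZ]] := reduce_mod_curve fZ.
have evE P x y : ec_coord P = Some (x, y) ->
  eval3 (fX, fY, fZ) x y =
  (X0.[x] + y * X1.[x], Y0.[x] + y * Y1.[x], Z0.[x] + y * Z1.[x]).
  by move=> /curve_eq h; rewrite /eval3 /= hX // hY // hZ.
have Znz : (Z0 != 0) || (Z1 != 0).
  (* If [Z] vanished on the curve, [phi] would send generic points, hence all points, to
     infinity. *)
  rewrite -negb_and; apply/negP => /andP[/eqP Z00 /eqP Z10]; apply: phi0.
  have gen (g0 g1 : {poly F}) : (g0 != 0) || (g1 != 0) ->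
    (forall P x y, ec_coord P = Some (x, y) -> g0.[x] + y * g1.[x] != 0 ->
      eval3 (fX, fY, fZ) x y <> (0, 0, 0)) -> phi = (fun=> ec_zero E).
    move=> nzg hg; apply: functional_extensionality_dep => P.
    apply: (ec_additive_eq0 ha (norm_neq0 nzg)) => Q [x [y [hQ b]]].
    have nz' := hg _ _ _ hQ (conj_nonzero hQ b).
    have [c c0] := hf _ _ _ hQ nz'; rewrite (evE _ _ _ hQ) /= Z00 Z10 !horner0 mulr0 addr0.
    move=> [_ _]; rewrite /proj_coord; case e : (ec_coord (phi Q)) => [[x' y']|] /=.
      by move/eqP; rewrite mulr1 eq_sym (negbTE c0).
    by move=> _; apply: val_inj.
  have [nX|] := boolP ((X0 != 0) || (X1 != 0)).
    by apply: (gen _ _ nX) => P x y hP n0; rewrite (evE _ _ _ hP) => -[e _ _]; rewrite e eqxx in n0.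
  have [nY _|] := boolP ((Y0 != 0) || (Y1 != 0)).
    by apply: (gen _ _ nY) => P x y hP n0; rewrite (evE _ _ _ hP) => -[_ e _]; rewrite e eqxx in n0.
  rewrite !negb_or !negbK => /andP[/eqP a1 /eqP a2] /andP[/eqP a3 /eqP a4].
  by case: nz; rewrite (evE _ _ _ hP0) a1 a2 a3 a4 Z00 Z10 !horner0 !mulr0 !addr0.
pose NZ := Z0 ^+ 2 - Z1 ^+ 2 * cubic.
have NZ0 : NZ != 0 := norm_neq0 Znz.
(* After multiplication by the conjugate [Z0 - y Z1], [U] is the even part of the first numerator
   and [y V] the odd part of the second. *)
pose U := X0 * Z0 - cubic * X1 * Z1.
pose V := Y1 * Z0 - Y0 * Z1.
have form P x y : ec_coord P = Some (x, y) -> NZ.[x] != 0 ->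
    exists x' y', ec_coord (phi P) = Some (x', y') /\
      X0.[x] + y * X1.[x] = x' * (Z0.[x] + y * Z1.[x]) /\
      Y0.[x] + y * Y1.[x] = y' * (Z0.[x] + y * Z1.[x]).
  move=> hP b; have Zx := conj_nonzero hP b.
  have nz' : eval3 (fX, fY, fZ) x y <> (0, 0, 0).
    by rewrite (evE _ _ _ hP) => -[_ _ e]; rewrite e eqxx in Zx.
  have [c c0] := hf _ _ _ hP nz'; rewrite (evE _ _ _ hP) /= /proj_coord.
  case: (ec_coord (phi P)) => [[x' y']|] /= [e1 e2 e3]; last first.
    by move: Zx; rewrite e3 mulr0 eqxx.
  exists x', y'; split=> //; rewrite e1 e2 e3 mulr1; split; exact: mulrC.
have vals P x y : ec_coord P = Some (x, y) -> (NZ * cubic).[x] != 0 ->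
    ec_coord (phi P) = Some (ratfun U NZ x, y * ratfun V NZ x).
  move=> hP; rewrite hornerM mulf_eq0 negb_or => /andP[b cx].
  have [x' [y' [e1 [e2 e3]]]] := form _ _ _ hP b.
  (* Comparing the values at [P] and [-P] separates even and odd parts. *)
  have [x'' [y'' [f1 [f2 f3]]]] := form _ _ _ (ec_coord_neg hP) b.
  have := ec_coord_neg e1; rewrite -ec_additiveN // f1 => -[ex ey].
  rewrite {}ex {}ey in f2 f3.
  have yn0 : y != 0 by apply: contraNneq cx => ye; rewrite -(curve_eq hP) ye expr0n.
  have two (u v : F) : 2%:R * u = 2%:R * v -> u = v by apply: mulfI.
  have g1 : X0.[x] = x' * Z0.[x].
    by apply: two; transitivity ((X0.[x] + y * X1.[x]) + (X0.[x] + - y * X1.[x]));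
      [ring | rewrite e2 f2; ring].
  have g2 : X1.[x] = x' * Z1.[x].
    apply: (mulfI yn0); apply: two.
    by transitivity ((X0.[x] + y * X1.[x]) - (X0.[x] + - y * X1.[x]));
      [ring | rewrite e2 f2; ring].
  have g3 : Y0.[x] = y' * y * Z1.[x].
    by apply: two; transitivity ((Y0.[x] + y * Y1.[x]) + (Y0.[x] + - y * Y1.[x]));
      [ring | rewrite e3 f3; ring].
  have g4 : y * Y1.[x] = y' * Z0.[x].
    apply: two; by transitivity ((Y0.[x] + y * Y1.[x]) - (Y0.[x] + - y * Y1.[x]));
      [ring | rewrite e3 f3; ring].
  rewrite e1; congr (Some (_, _)).
    apply: (mulIf b); rewrite /ratfun divfK // /U /NZ; horner_simpl.
    by rewrite g1 g2; ring.
  apply: (mulIf b); rewrite /ratfun mulrA divfK // /V /NZ; horner_simpl.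
  rewrite -(curve_eq hP) [RHS]mulrBr (mulrA y Y1.[x]) g4 g3; ring.
pose g := gcdp U NZ.
have g0 : g != 0 by rewrite gcdp_eq0 (negbTE NZ0) andbF.
have eU : U = (U %/ g) * g by rewrite divpK // dvdp_gcdl.
have eN : NZ = (NZ %/ g) * g by rewrite divpK // dvdp_gcdr.
exists (U %/ g), (NZ %/ g), V, NZ, (NZ * cubic); split.
- by apply: coprimep_div_gcd; rewrite NZ0 orbT.
- by rewrite mulf_neq0 // cubic_neq0.
move=> P x y hP b; have v := vals _ _ _ hP b.
move: b; rewrite hornerM mulf_eq0 negb_or => /andP[b _].
move: (b); rewrite {1}eN hornerM mulf_eq0 negb_or => /andP[b1 b2].
split=> //; rewrite v; congr (Some (_, _)).
by rewrite /ratfun {1}eU {1}eN !hornerM -mulf_div divff // mulr1.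
Qed.

(** If generic points all had images of abscissa [t], then [phi Q] would be [phi P] or its negative,
    and [phi] would send [P - Q] or [P + Q] to infinity although both are generic. *)
Lemma normal_form_nonconstant phi U W V T B : ec_additive phi ->
  normal_form phi U W V T B -> nonconstant U W.
Proof.
move=> ha [cUW B0 nf].
have [P [x1 [y1 [hP b1]]]] := exists_point_avoiding B0.
have W0 : W != 0 by have [Wx _ _] := nf _ _ _ hP b1; apply: contraNneq Wx => ->; rewrite horner0.
split=> // t; apply/eqP => eU.
have fib Q x y : ec_coord Q = Some (x, y) -> B.[x] != 0 ->
    exists y', ec_coord (phi Q) = Some (t, y').
  move=> hQ b; have [Wx _ e] := nf _ _ _ hQ b; exists (y * ratfun V T x).
  by rewrite e /ratfun eU hornerZ mulfK.
have [B' B'0 h] := translate_avoid hP B0.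
have [Q [x2 [y2 [hQ]]]] := exists_point_avoiding (mulf_neq0 B0 B'0).
rewrite hornerM mulf_eq0 negb_or => /andP[b b'].
have [_ [x3 [y3 [h3 b3]]]] := h _ _ _ hQ b'.
have [_ [x4 [y4 [h4 b4]]]] := h _ _ _ (ec_coord_neg hQ) b'.
have [u1 f1] := fib _ _ _ hP b1; have [u2 f2] := fib _ _ _ hQ b.
have [u3 f3] := fib _ _ _ h3 b3; have [u4 f4] := fib _ _ _ h4 b4.
have [e|e] := ec_same_x f1 f2.
  by move: f4; rewrite ha ec_additiveN // e ec_addN.
by move: f3; rewrite ha e ec_addN.
Qed.

End CurveMaps.

(** * Identities outside finitely many abscissas *)

Section Generic.
Variables (F : closedFieldType) (l : nat).
Hypothesis charFl : l \in [pchar F].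
Implicit Types (p U W B A D : {poly F}) (x y z t : F) (S : F -> Prop).

Let l_prime : prime l. Proof. exact: pcharf_prime charFl. Qed.

Definition generically S := exists2 B, B != 0 & forall x, B.[x] != 0 -> S x.

Lemma generically_and S1 S2 : generically S1 -> generically S2 ->
  generically (fun x => S1 x /\ S2 x).
Proof.
move=> [B1 n1 h1] [B2 n2 h2]; exists (B1 * B2); first by rewrite mulf_neq0.
move=> x; rewrite hornerM mulf_eq0 negb_or => /andP[b1 b2].
by split; [apply: h1 | apply: h2].
Qed.

Lemma generically_impl S1 S2 : (forall x, S1 x -> S2 x) ->
  generically S1 -> generically S2.
Proof. by move=> h [B B0 hB]; exists B => // x /hB /h. Qed.

Lemma generically_nonroot B : B != 0 -> generically (fun x => B.[x] != 0).
Proof. by exists B. Qed.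

Lemma generically_comp U W S : nonconstant U W -> generically S ->
  generically (fun x => W.[x] != 0 /\ S (ratfun U W x)).
Proof.
move=> nc [B B0 hB]; have [B' B'0 h] := nonconstant_avoid nc B0.
by exists B' => // x /h[Wx /hB Sx].
Qed.

Lemma generically_pow (m : nat) S : (0 < m)%N -> generically S ->
  generically (fun x => S (x ^+ m)).
Proof.
move=> m0 [B B0 hB]; exists (B \Po 'X^m).
  by rewrite comp_poly_eq0 // size_polyXn.
by move=> x; rewrite horner_compXn; apply: hB.
Qed.

Lemma generically_frobenius (e : nat) S : generically S ->
  generically (fun z => exists2 x, x ^+ (l ^ e) = z & S x).
Proof.
move=> [B B0 hB]; have [B' hB'] := frobenius_twist charFl e B.
have [x0 Bx0] := exists_nonroot B0; exists B'.
  apply: contraNneq Bx0 => e0; have [+ _] := hB' x0.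
  rewrite e0 horner0 => /esym/eqP; by rewrite expf_eq0 => /andP[].
move=> z; have [x <-] := exists_root_exp z (pchar_exp_gt0 charFl e).
have [-> _] := hB' x => Bx; exists x => //; apply: hB.
by apply: contraNneq Bx => ->; rewrite expr0n gtn_eqF // (pchar_exp_gt0 charFl).
Qed.

(** Moves a power of Frobenius from the outside of a separable function to the inside. *)
Lemma ratfun_twist (e : nat) U W : wronskian U W != 0 ->
  exists U' W', wronskian U' W' != 0 /\
    forall x, ratfun U' W' (x ^+ (l ^ e)) = ratfun U W x ^+ (l ^ e).
Proof.
move=> w; have [U' hU] := frobenius_twist charFl e U.
have [W' hW] := frobenius_twist charFl e W; exists U', W'; split.
  have [x wx] := exists_nonroot w.
  apply: contraNneq wx => /(congr1 (fun p => p.[x ^+ (l ^ e)])).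
  rewrite horner0 /wronskian !hornerD !hornerN !hornerM.
  have [-> ->] := hU x; have [-> ->] := hW x; rewrite -!exprMn => /eqP.
  by rewrite subr_eq0 => /eqP/(expr_pchar_inj charFl) ->; rewrite subrr.
by move=> x; have [e1 _] := hU x; have [e2 _] := hW x; rewrite /ratfun e1 e2 expr_div_n.
Qed.

Lemma ratfun_compXn (m : nat) U W x :
  ratfun (U \Po 'X^m) (W \Po 'X^m) x = ratfun U W (x ^+ m).
Proof. by rewrite /ratfun !horner_compXn. Qed.

(** Suppose [r < e], and move all Frobenius powers inside. In [z = x^(l^(2r))] the left side is a
    composite of separable functions, while the right side is a function of [z^(l^(2(e-r)))],
    against [separable_comp]. *)
Lemma frobenius_exponent_le (r e : nat) (U W Ul Wl UM WM : {poly F}) :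
  wronskian U W != 0 -> wronskian Ul Wl != 0 -> WM != 0 ->
  generically (fun x =>
    ratfun U W (ratfun U W (x ^+ (l ^ r)) ^+ (l ^ r)) =
    ratfun UM WM (ratfun Ul Wl (ratfun Ul Wl (x ^+ (l ^ e)) ^+ (l ^ e)))) ->
  (e <= r)%N.
Proof.
move=> w wl WM0 h; rewrite leqNgt; apply/negP => re.
have [U' [W' [w' tU]]] := ratfun_twist r w.
have [Ul' [Wl' [wl' tUl]]] := ratfun_twist e wl.
have [A1 [D1 [B1 [B10 h1]]]] := ratfun_comp UM WM0 (wronskian_nonconstant wl).
have D10 : D1 != 0.
  have [x /h1[D1x _]] := exists_nonroot B10.
  by apply: contraNneq D1x => ->; rewrite horner0.
have [A2 [D2 [B2 [B20 h2]]]] := ratfun_comp A1 D10 (wronskian_nonconstant wl').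
have D20 : D2 != 0.
  have [x /h2[D2x _]] := exists_nonroot B20.
  by apply: contraNneq D2x => ->; rewrite horner0.
pose d := (e - r)%N; have d0 : (0 < d)%N by rewrite subn_gt0.
pose s := (l ^ (d + d))%N.
have s0 : (0 < s)%N by rewrite expn_gt0 prime_gt0.
have ds p : (p \Po 'X^s)^`() = 0 :> {poly F}.
  rewrite deriv_comp derivXn -scaler_nat.
  have /eqP -> : (s%:R : F) == 0.
    by rewrite -(dvdn_pcharf charFl) dvdn_exp // addn_gt0 d0.
  by rewrite scale0r mulr0.
have q0 : (0 < l ^ e * l ^ e)%N by rewrite muln_gt0 expn_gt0 prime_gt0.
have g1 := generically_pow q0 (generically_comp (wronskian_nonconstant wl')
  (generically_nonroot B10)).
have g2 := generically_pow q0 (generically_nonroot B20).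
have g := generically_frobenius (r + r) (generically_and h (generically_and g1 g2)).
have [B B0 hB] := g.
apply: (separable_comp w w' (ds A2) (ds D2) _ B0 (A := A2 \Po 'X^s)).
  by rewrite comp_poly_eq0 // size_polyXn.
move=> z /hB[x <- [hx [[_ b1] b2]]].
rewrite ratfun_compXn.
have -> : (x ^+ (l ^ (r + r))) ^+ s = x ^+ (l ^ e * l ^ e).
  by rewrite -exprM -!expnD addnACA subnKC // ltnW.
have [_ <-] := h2 _ b2; have [_ <-] := h1 _ b1.
by rewrite expnD !exprM tU tUl.
Qed.

Lemma horner_size2 p x : (size p <= 2)%N -> p.[x] = p`_1 * x + p`_0.
Proof.
move=> s; rewrite (horner_coef_wide _ s) !big_ord_recl big_ord0 /= addr0.
by rewrite expr0 expr1 mulr1 addrC.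
Qed.

(** Inverting the Moebius map gives [num / den] at [x^(l^e)], and the [l^e]-th root is extracted
    coefficientwise by [frobenius_untwist]. *)
Lemma moebius_solve (e : nat) (Ul Wl U W : {poly F}) :
  (size Ul <= 2)%N -> (size Wl <= 2)%N -> wronskian Ul Wl != 0 ->
  nonconstant U W ->
  exists A D, nonconstant A D /\ generically (fun x =>
    ratfun Ul Wl (ratfun A D x ^+ (l ^ e)) = ratfun U W (x ^+ (l ^ e))).
Proof.
move=> sU sW w [W0 nc]; have q0 := pchar_exp_gt0 charFl e.
set a := Ul`_1; set b := Ul`_0; set c := Wl`_1; set d := Wl`_0.
have UlE x : Ul.[x] = a * x + b by apply: horner_size2.
have WlE x : Wl.[x] = c * x + d by apply: horner_size2.
have det : a * d - b * c != 0.
  apply: contraNneq w => e0.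
  have eU : Ul = a *: 'X + b%:P.
    apply: (@poly_eq_generic _ 1 _ _ (oner_neq0 _)) => x _.
    by rewrite UlE; horner_simpl.
  have eW : Wl = c *: 'X + d%:P.
    apply: (@poly_eq_generic _ 1 _ _ (oner_neq0 _)) => x _.
    by rewrite WlE; horner_simpl.
  apply/eqP; apply: (@poly_eq_generic _ 1 _ _ (oner_neq0 _)) => x _.
  rewrite horner0 -e0 eU eW /wronskian !derivE; horner_simpl; ring.
pose num := d *: U - b *: W; pose den := a *: W - c *: U.
have lin (u v : F) : u *: U = v *: W -> u = 0 /\ v = 0.
  have [->|u0] := eqVneq u 0.
    by rewrite scale0r => /esym/eqP; rewrite scaler_eq0 (negbTE W0) orbF => /eqP.
  move=> e0; have /eqP[] := nc (v / u).
  by rewrite mulrC -scalerA -e0 scalerA mulVf // scale1r.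
have den0 : den != 0.
  apply: contraNneq det => /eqP; rewrite subr_eq0 => /eqP/esym/lin[-> ->].
  by rewrite mul0r mulr0 subrr.
have [A hA] := frobenius_untwist charFl e num.
have [D hD] := frobenius_untwist charFl e den.
have D0 : D != 0.
  apply: contraNneq den0 => e0; apply/eqP.
  apply: (@poly_eq_generic _ 1 _ _ (oner_neq0 _)) => z _.
  have [x <-] := exists_root_exp z q0.
  by rewrite hD e0 !horner0 expr0n gtn_eqF.
exists A, D; split.
  split=> // t; apply: contraNneq det => e0.
  (* A constant quotient gives a linear relation between [U] and [W], hence a vanishing
     determinant. *)
  have eN : num = t ^+ (l ^ e) *: den.
    apply: (@poly_eq_generic _ 1 _ _ (oner_neq0 _)) => z _.
    have [x <-] := exists_root_exp z q0.
    by rewrite hornerZ hA hD e0 hornerZ exprMn.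
  have /lin[f1 f2] : (d + t ^+ (l ^ e) * c) *: U = (b + t ^+ (l ^ e) * a) *: W.
    apply/eqP; rewrite -subr_eq0; apply/eqP.
    transitivity (num - t ^+ (l ^ e) *: den); last by rewrite eN subrr.
    by rewrite /num /den -!mul_polyC !(polyCD, polyCM); ring.
  move/eqP: f1; rewrite addr_eq0 => /eqP ->; move/eqP: f2; rewrite addr_eq0 => /eqP ->.
  by apply/eqP; ring.
apply: generically_impl (generically_and (generically_nonroot D0)
  (generically_pow q0 (generically_nonroot W0))) => x [Dx Wx].
have denx : den.[x ^+ (l ^ e)] != 0 by rewrite hD expf_neq0.
have zE : ratfun A D x ^+ (l ^ e) = num.[x ^+ (l ^ e)] / den.[x ^+ (l ^ e)].
  by rewrite /ratfun expr_div_n -hA -hD.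
rewrite zE /ratfun UlE WlE; move: denx Wx; rewrite /num /den; horner_simpl.
move: (U.[_]) (W.[_]) => u v denx v0.
have -> : c * ((d * u - b * v) / (a * v - c * u)) + d = (a * d - b * c) * v / (a * v - c * u).
  by field.
have -> : a * ((d * u - b * v) / (a * v - c * u)) + b = (a * d - b * c) * u / (a * v - c * u).
  by field.
by field; rewrite denx v0 det.
Qed.

End Generic.

(** * Dividing an endomorphism by an injective one *)

Section Divisibility.
Variables (F : closedFieldType) (l : nat).
Hypothesis charFl : l \in [pchar F].
Hypothesis two_neq0 : (2%:R : F) != 0.
Variable E : ell_curve F.
Implicit Types (P Q : ec_point E) (U W V T B : {poly F}) (x y : F).
Implicit Types (phi psi : ec_point E -> ec_point E) (g : F -> F).

Definition xmap phi g := generically (fun x => forall P y,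
  ec_coord P = Some (x, y) -> exists y', ec_coord (phi P) = Some (g x, y')).

Lemma normal_form_xmap phi U W V T B :
  normal_form phi U W V T B -> xmap phi (ratfun U W).
Proof.
move=> [_ B0 h]; exists B => // x Bx P y hP; have [_ _ ->] := h _ _ _ hP Bx.
by exists (y * ratfun V T x).
Qed.

Lemma xmap_comp phi psi g U W : xmap phi g -> xmap psi (ratfun U W) ->
  nonconstant U W -> xmap (phi \o psi) (g \o ratfun U W).
Proof.
move=> h1 h2 nc; apply: generically_impl (generically_and h2 (generically_comp nc h1)).
by move=> x [e2 [_ e1]] P y hP; have [y' /e1] := e2 _ _ hP.
Qed.

Lemma xmap_unique phi g1 g2 : xmap phi g1 -> xmap phi g2 ->
  generically (fun x => g1 x = g2 x).
Proof.
move=> h1 h2; apply: generically_impl (generically_and h1 h2) => x [e1 e2].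
have [P [y hP]] := exists_point_above E x.
by have [y1] := e1 _ _ hP; have [y2 ->] := e2 _ _ hP; case.
Qed.

Lemma rational_of_generic psi U W V T :
  generically (fun x => [/\ W.[x] != 0, T.[x] != 0 & forall P y,
    ec_coord P = Some (x, y) ->
    ec_coord (psi P) = Some (ratfun U W x, y * ratfun V T x)]) ->
  given_by_rational_functions psi.
Proof.
move=> [B B0 h].
(* The factor [B] makes all three coordinates vanish at the exceptional points, where nothing is
   known. *)
exists ((B * U * T)%:P, (B * W * V) *: 'X, (B * W * T)%:P).
have evE x y : eval3 ((B * U * T)%:P, (B * W * V) *: 'X, (B * W * T)%:P) x y =
  (B.[x] * U.[x] * T.[x], B.[x] * W.[x] * V.[x] * y, B.[x] * W.[x] * T.[x]).
  by rewrite /eval3 /= !hornerC hornerZ hornerX !hornerM hornerC.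
split.
  have [P [x [y [hP Bx]]]] := exists_point_avoiding E B0; exists P, x, y; split=> //.
  have [Wx Tx _] := h _ Bx; rewrite evE => -[_ _ /eqP].
  by rewrite !mulf_eq0 (negbTE Bx) (negbTE Wx) (negbTE Tx).
move=> P x y hP; rewrite evE => nz.
have Bx : B.[x] != 0 by apply/eqP => e; apply: nz; rewrite e !mul0r.
have [Wx Tx /(_ _ _ hP) e] := h _ Bx.
exists (B.[x] * W.[x] * T.[x]); first by rewrite !mulf_neq0.
rewrite /proj_coord e /= /ratfun mulr1; split=> //; by field.
Qed.

Lemma ec_additive_inj (lam : ec_point E -> ec_point E) : ec_additive lam ->
  (forall P, lam P = ec_zero E -> P = ec_zero E) -> injective lam.
Proof.
move=> ha h P Q e; have : ec_add P (ec_neg Q) = ec_zero E.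
  by apply: h; rewrite ha ec_additiveN // e ec_addN.
move/(ec_add_eq0) => e'; apply: val_inj; move/(congr1 (@ec_coord _ _)): e' => /=.
case: (ec_coord P) => [[x y]|]; case: (ec_coord Q) => [[x' y']|] //= [-> /oppr_inj ->] //.
Qed.

(* [lam] is a Moebius map after a power [q] of Frobenius on abscissas, and
   [phi] factors through the same power, so [lam^-1 phi] has rational
   abscissa; its ordinate is then the quotient of those of [phi] and [lam]. *)
Lemma ec_End_divide (lam phi M : ec_point E -> ec_point E) :
  ec_End lam -> ec_End phi -> ec_End M -> injective lam ->
  phi <> (fun=> ec_zero E) -> M <> (fun=> ec_zero E) ->
  (forall P, phi (phi P) = M (lam (lam P))) ->
  exists2 psi, ec_End psi & forall P, lam (psi P) = phi P.
Proof.
move=> Elam Ephi EM inj phi0 M0 hsq.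
have alam : ec_additive lam by case: Elam.
have aphi : ec_additive phi by case: Ephi.
have aM : ec_additive M by case: EM.
have lam0 : lam <> (fun=> ec_zero E).
  move=> e; have [P [y hP]] := exists_point_above E 0.
  have : P = ec_zero E by apply: inj; rewrite e.
  by move/(congr1 (@ec_coord _ _)); rewrite hP.
have [U [W [V [T [B nf]]]]] := exists_normal_form two_neq0 Ephi phi0.
have [Ul [Wl [Vl [Tl [Bl nfl]]]]] := exists_normal_form two_neq0 Elam lam0.
have [UM [WM [VM [TM [BM nfM]]]]] := exists_normal_form two_neq0 EM M0.
have nc := normal_form_nonconstant two_neq0 aphi nf.
have ncl := normal_form_nonconstant two_neq0 alam nfl.
have [WM0 _] := normal_form_nonconstant two_neq0 aM nfM.
have xm := normal_form_xmap nf; have xml := normal_form_xmap nfl.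
have xmM := normal_form_xmap nfM.
have [cUW B0 hphi] := nf; have [cl Bl0 hlam] := nfl.
have [r [U1 [W1 [eU eW c1 w1]]]] := frobenius_factor charFl cUW nc.
have [e [Ul1 [Wl1 [eUl eWl cl1 wl1]]]] := frobenius_factor charFl cl ncl.
have sq : generically (fun x => ratfun U W (ratfun U W x) =
    ratfun UM WM (ratfun Ul Wl (ratfun Ul Wl x))).
  have x1 := xmap_comp xm xm nc.
  have x2 := xmap_comp (xmap_comp xmM xml ncl) xml ncl.
  have ee : phi \o phi = (M \o lam) \o lam by apply: functional_extensionality_dep.
  by rewrite ee in x1; exact: xmap_unique x1 x2.
have er : (e <= r)%N.
  apply: (frobenius_exponent_le charFl w1 wl1 WM0 (UM := UM)).
  by apply: generically_impl sq => x; rewrite eU eW eUl eWl !ratfun_compXn.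
(* Equal abscissas of the images mean [lam P' = lam P] or [lam P' = lam (-P)]. *)
have injx : forall x x', Bl.[x] != 0 -> Bl.[x'] != 0 ->
    ratfun Ul Wl x = ratfun Ul Wl x' -> x = x'.
  move=> x x' b b' ex.
  have [P [y hP]] := exists_point_above E x; have [P' [y' hP']] := exists_point_above E x'.
  have [_ _ f] := hlam _ _ _ hP b; have [_ _ f'] := hlam _ _ _ hP' b'.
  rewrite -ex in f'; have [|/esym] := ec_same_x f f'.
    by move/inj => eP; move: hP'; rewrite eP hP => -[].
  rewrite -ec_additiveN // => /inj eP; move: hP'; rewrite -eP (ec_coord_neg hP).
  by case.
have [sU sW] : (size Ul1 <= 2)%N /\ (size Wl1 <= 2)%N.
  have [Bz Bz0 hBz] := generically_frobenius charFl e (generically_nonroot Bl0).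
  apply: (injective_ratfun_size cl1 wl1 Bz0) => z z' /hBz[x <- b] /hBz[x' <- b'].
  by rewrite -!ratfun_compXn -eUl -eWl => /(injx _ _ b b') ->.
(* Only [e] of the [r] Frobenius factors of [phi] are split off, to match those of [lam]. *)
pose U2 := U1 \Po 'X^(l ^ (r - e)); pose W2 := W1 \Po 'X^(l ^ (r - e)).
have ere : (l ^ r = l ^ (r - e) * l ^ e)%N by rewrite -expnD subnK.
have eU2 : U = U2 \Po 'X^(l ^ e).
  by rewrite eU /U2 -comp_polyA comp_Xn_poly -exprM ere mulnC.
have eW2 : W = W2 \Po 'X^(l ^ e).
  by rewrite eW /W2 -comp_polyA comp_Xn_poly -exprM ere mulnC.
have nc2 : nonconstant U2 W2.
  by apply: (nonconstant_compXn (pchar_exp_gt0 charFl e)); rewrite -eU2 -eW2.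
have [A [D [ncAD hAD]]] := moebius_solve charFl e sU sW wl1 nc2.
have hAD' : generically (fun x => ratfun Ul Wl (ratfun A D x) = ratfun U W x).
  by apply: generically_impl hAD => x; rewrite eUl eWl eU2 eW2 !ratfun_compXn.
(* If [Vl] vanished at [x], then [lam Q] would equal [lam (-Q)], so [Q = -Q] and [y = 0], excluded
   by [cubic]. *)
have Vl_neq0 x : (Bl * cubic E).[x] != 0 -> Tl.[x] != 0 /\ Vl.[x] != 0.
  rewrite hornerM mulf_eq0 negb_or => /andP[b cx].
  have [Q [y hQ]] := exists_point_above E x; have [_ Tx f] := hlam _ _ _ hQ b.
  split=> //; apply: contraNneq cx => v0; rewrite -(curve_eq hQ).
  have : ec_neg Q = Q.
    apply: inj; rewrite ec_additiveN //; apply: val_inj => /=.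
    by rewrite f /ratfun v0 mul0r mulr0 /= oppr0.
  move/(congr1 (@ec_coord _ _)); rewrite (ec_coord_neg hQ) hQ => -[/eqP].
  rewrite eq_sym -addr_eq0 -mulr2n -mulr_natl mulf_eq0 (negbTE two_neq0) /= => /eqP ->.
  by rewrite expr0n.
have Bc0 : Bl * cubic E != 0 by rewrite mulf_neq0 // cubic_neq0.
have Vl0 : Vl != 0.
  have [x /Vl_neq0[_ vx]] := exists_nonroot Bc0.
  by apply: contraNneq vx => ->; rewrite horner0.
(* The reciprocal of the ordinate factor of [lam], taken at the new abscissa [A / D]. *)
have [V3 [T3 [B3 [B30 h3]]]] := ratfun_comp Tl Vl0 ncAD.
have lift : generically (fun x => [/\ D.[x] != 0, (T * T3).[x] != 0 & forall P y,
    ec_coord P = Some (x, y) -> exists Q, lam Q = phi P /\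
      ec_coord Q = Some (ratfun A D x, y * ratfun (V * V3) (T * T3) x)]).
  have gg := generically_and (generically_and hAD' (generically_nonroot B0))
    (generically_and (generically_nonroot B30) (generically_comp ncAD (generically_nonroot Bc0))).
  apply: generically_impl gg => x [[hx Bx] [B3x [Dx bx]]].
  have [T3x e3] := h3 _ B3x.
  have [Tlx Vlx] := Vl_neq0 _ bx.
  have Tx : T.[x] != 0.
    by have [P [y hP]] := exists_point_above E x; have [_ Tx _] := hphi _ _ _ hP Bx.
  split=> //; first by rewrite hornerM mulf_neq0.
  move=> P y hP; have [_ _ fP] := hphi _ _ _ hP Bx.
  have blx : Bl.[ratfun A D x] != 0.
    by move: bx; rewrite hornerM mulf_eq0 negb_or => /andP[].
  have [Q0 [y0 hQ0]] := exists_point_above E (ratfun A D x).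
  (* The image of [Q0] has the abscissa of [phi P], so it is right up to sign. *)
  have [Q [y' [hQ lQ]]] : exists Q y', ec_coord Q = Some (ratfun A D x, y') /\ lam Q = phi P.
    have [_ _ f0] := hlam _ _ _ hQ0 blx; rewrite hx in f0.
    have [->|->] := ec_same_x f0 fP; first by exists Q0, y0.
    exists (ec_neg Q0), (- y0); rewrite (ec_coord_neg hQ0) ec_additiveN //.
  exists Q; split=> //; rewrite hQ; congr (Some (_, _)).
  have [_ _ fQ] := hlam _ _ _ hQ blx; move: fQ; rewrite lQ fP => -[_ ey].
  have -> : ratfun (V * V3) (T * T3) x = ratfun V T x * ratfun V3 T3 x.
    by rewrite /ratfun !hornerM mulf_div.
  rewrite -e3 mulrA ey -mulrA /ratfun mulf_div [X in _ / X]mulrC.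
  by rewrite divff ?mulr1 // mulf_neq0.
have ex : forall P, exists Q, lam Q = phi P.
  move=> P; have [B4 B40 h4] := lift.
  have [Q1 [Q2 [-> [x1 [y1 [f1 b1]]] [x2 [y2 [f2 b2]]]]]] := sum_of_generic two_neq0 P B40.
  have [_ _ /(_ _ _ f1)[R1 [e1 _]]] := h4 _ b1.
  have [_ _ /(_ _ _ f2)[R2 [e2 _]]] := h4 _ b2.
  by exists (ec_add R1 R2); rewrite alam e1 e2 aphi.
have [psi hpsi] := choice ex.
exists psi => //; split.
  by move=> P Q; apply: inj; rewrite alam !hpsi aphi.
apply: (rational_of_generic (U := A) (W := D) (V := V * V3) (T := T * T3)).
apply: generically_impl lift => x [Dx TTx hx]; split=> // P y hP.
by have [Q [lQ <-]] := hx _ _ hP; congr ec_coord; apply: inj; rewrite hpsi lQ.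
Qed.

End Divisibility.

(** * The square root of the discriminant in the order *)

Section QuadraticOrderElements.
Variable n : nat.

Lemma sqrtDelta_in_order : sqrtDelta n \in quad_pred n.
Proof.
(* The square root is [2 omega - Delta]. *)
apply/asboolP; exists (- Delta n), 2%:Z.
by rewrite /omega mulrNz -[2%:Z%:~R]/(2%:R) mulrCA divff ?pnatr_eq0 // mulr1 addKr.
Qed.

Definition quad_sqrt : quad_order n := QuadOrder sqrtDelta_in_order.

Lemma quad_sqrt_sqr : quad_sqrt * quad_sqrt = (Delta n)%:~R.
Proof.
by apply: val_inj; rewrite rmorphM rmorph_int /= -expr2 sqrtCK.
Qed.

Lemma omega_not_real : (1 <= n)%N -> omega n \isn't Num.real.
Proof.
move=> hn; apply/negP => h.
have sr : sqrtDelta n \is Num.real.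
  have -> : sqrtDelta n = 2%:R * omega n - (Delta n)%:~R.
    by rewrite /omega mulrCA divff ?pnatr_eq0 // mulr1 addrC addKr.
  apply: realB; first by apply: realM => //; exact: realn.
  exact: realz.
have : 0 <= sqrtDelta n ^+ 2 by rewrite -realEsqr.
rewrite sqrtCK ler0z /Delta; lia.
Qed.

(** From [l (a + b omega) = 2 omega - Delta] and [omega] not real, [l b = 2], impossible for
    [l >= 5]. *)
Lemma quad_sqrt_not_divisible (l : nat) (y : quad_order n) :
  (1 <= n)%N -> (5 <= l)%N -> l%:R * y <> quad_sqrt.
Proof.
move=> hn hl /(congr1 val); rewrite rmorphM rmorph_nat.
case: y => y /= yp; move: (yp) => /asboolP[a [b ->]] e.
have se : sqrtDelta n = 2%:R * omega n - (Delta n)%:~R.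
  by rewrite /omega mulrCA divff ?pnatr_eq0 // mulr1 addrC addKr.
have e1 : ((l%:Z * b - 2) %:~R : algC) * omega n = (- Delta n - l%:Z * a)%:~R.
  rewrite !rmorphB !rmorphM /= rmorphN /=.
  have -> : (l%:Z%:~R : algC) = l%:R by [].
  transitivity (l%:R * (a%:~R + b%:~R * omega n) - 2%:R * omega n - l%:R * a%:~R); first by ring.
  by rewrite e se; ring.
have [z|nz] := eqVneq (l%:Z * b - 2) 0.
  have [b0|b0] : b <= 0 \/ 1 <= b by lia.
    by nia.
  by nia.
have := omega_not_real hn; case/negP.
have -> : omega n = (- Delta n - l%:Z * a)%:~R / (l%:Z * b - 2)%:~R.
  by rewrite -e1 mulrC mulKf // intr_eq0.
by apply: rpred_div; exact: realz.
Qed.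

End QuadraticOrderElements.

Lemma prime_sqr_mod6 (p : nat) : prime p -> (5 <= p)%N -> (p * p = 1 %[mod 6])%N.
Proof.
move=> pp p5.
have nd q : prime q -> (q < 5)%N -> (q %| 6)%N -> ~~ (q %| p %% 6)%N.
  move=> pq q5 q6; rewrite /dvdn modn_dvdm // -/(q %| p)%N dvdn_prime2 //.
  by rewrite ltn_eqF // (leq_trans q5).
have := nd 2%N isT isT isT; have := nd 3%N isT isT isT.
rewrite -modnMm; have : (p %% 6 < 6)%N by rewrite ltn_mod.
by case: (p %% 6)%N => [|[|[|[|[|[|k]]]]]].
Qed.

(** * Supersingularity excludes optimal embeddings *)

Section NoOptimalEmbedding.
Variables (F : closedFieldType) (l : nat).
Hypothesis charFl : l \in [pchar F].
Hypothesis l_ge5 : (5 <= l)%N.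
Variables (E : ell_curve F) (C : set (ec_point E)) (n : nat).
Hypothesis E_ss : supersingular E l.
Hypothesis C_cyc : cyclic_of_order 6 C.
Hypothesis n_gt0 : (1 <= n)%N.
Hypothesis l2_dvd : ((l ^ 2)%N%:Z %| Delta n)%Z.

Let two_neq0 : (2%:R : F) != 0.
Proof.
rewrite -(dvdn_pcharf charFl); apply/negP => /dvdn_leq; lia.
Qed.

Lemma embedding_nat (iota : quad_order n -> ec_point E -> ec_point E) (m : nat) P :
  is_embedding C iota -> iota m%:R P = ec_mul m P.
Proof.
move=> [_ i1 iD _ _]; elim: m => [|m IH].
  apply: (ec_addP_eq two_neq0); by have /(congr1 (@^~ P)) /= := iD 0 0; rewrite addr0.
by rewrite -addn1 natrD addrC iD /ec_addf i1 IH addnC.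
Qed.

Lemma no_optimal_embedding (iota : quad_order n -> ec_point E -> ec_point E) :
  is_embedding C iota -> ~ is_optimal C iota.
Proof.
move=> ie opt; have inat := embedding_nat _ _ ie.
have [iR i1 iD iM iinj] := ie.
(* Read off from multiplication in the order, in place of an argument by associativity. *)
have imul a b (P : ec_point E) : ec_mul (a * b) P = ec_mul a (ec_mul b P).
  by rewrite -!inat natrM iM.
pose lam := iota l%:R; pose phi := iota (quad_sqrt n).
have /dvdzP[m em] := l2_dvd.
pose M := iota m%:~R.
have End x : ec_End (iota x) by case: (iR x).
have izero : iota 0 = (fun=> ec_zero E).
  by apply: functional_extensionality_dep => P; rewrite -[0]/(0%:R) inat.
have m0 : m != 0.
  apply: contraTneq isT => m0; move: em; rewrite m0 mul0r /Delta; lia.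
have lam_inj : injective lam.
  apply: ec_additive_inj => //; first by case: (End l%:R).
  by move=> P; rewrite /lam inat; apply: E_ss.
have DeltaE : (Delta n)%:~R = m%:~R * (l%:R * l%:R) :> quad_order n.
  by rewrite em intrM -natrM mulnn.
have [psi Epsi hpsi] : exists2 psi, ec_End psi & forall P, lam (psi P) = phi P.
  apply: (ec_End_divide charFl two_neq0 (End _) (End _) (End m%:~R) lam_inj).
  - rewrite /phi -izero => /iinj e.
    have := quad_sqrt_sqr n; rewrite e mul0r => /(congr1 val).
    rewrite rmorph_int rmorph0 => /esym/eqP; rewrite intr_eq0 em mulf_eq0 (negbTE m0) /=.
    by rewrite eqz_nat expn_eq0; lia.
  - rewrite -izero => /iinj/(congr1 val)/eqP; rewrite rmorph_int rmorph0 intr_eq0.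
    by rewrite (negbTE m0).
  move=> P; have := quad_sqrt_sqr n; rewrite DeltaE => e.
  by rewrite -[LHS]/((phi \o phi) P) /phi -iM e !iM.
have psiC P : C P -> C (psi P).
  move=> CP; have [G [eC G6 _]] := C_cyc.
  have : C (phi P) by case: (iR (quad_sqrt n)) => _; apply.
  rewrite eC => -[i _ hi].
  (* [l] is its own inverse modulo 6 *)
  exists (l * i)%N => //; apply: lam_inj; rewrite hpsi -hi /lam inat -imul.
  have [t ->] : exists t, (l * (l * i) = i + 6 * t)%N.
    have l2 := prime_sqr_mod6 (pcharf_prime charFl) l_ge5.
    exists ((l * l) %/ 6 * i)%N.
    rewrite mulnA {1}(divn_eq (l * l) 6) l2 /=; lia.
  have mul0 (j : nat) : ec_mul j (ec_zero E) = ec_zero E.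
    by elim: j => //= j ->; apply: val_inj.
  by rewrite -inat natrD iD /ec_addf !inat mulnC imul G6 mul0 ec_add0.
have Rpsi : ec_End_level C psi by split.
have : (image_of_K iota `&` ec_End_level C) psi.
  split=> //; exists l, (quad_sqrt n); split; first by lia.
  by apply: functional_extensionality_dep => P; rewrite /ec_mulf -inat -/lam hpsi.
(* Optimality puts [psi] in the image of the order, so the square root would be [l y]. *)
rewrite opt => -[y _ ey].
apply: (@quad_sqrt_not_divisible n l y) => //; apply: iinj.
by apply: functional_extensionality_dep => P; rewrite iM -[LHS]/(lam (iota y P)) ey hpsi.
Qed.

End NoOptimalEmbedding.

Unset Implicit Arguments.

Theorem theorem4p8 (n l k : nat) (hn : (1 <= n)%N)
  (l_prime : prime l) (hl : (5 <= l)%N)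
  (hv : logn l `|Delta n|%N = (2 * k)%N) (hk : (2 <= 2 * k)%N)
  (F : closedFieldType) (f : {rmorphism 'F_l -> F})
  (F_alg : forall x : F, algebraicOver f x)
  (E : ell_curve F) (E_ss : supersingular E l)
  (C : set (ec_point E)) (C_cyc : cyclic_of_order 6 C)
  (theta : forall p : nat, (ec_point E -> ec_point E) -> 'M[padic p]_2)
  (theta_id : forall p : nat, prime p -> (p %| 6)%N ->
     local_identification C (theta p))
  (str : forall p : nat, quad_order n -> padic p)
  (str_hom : forall p : nat, prime p -> (p %| 6)%N ->
     is_structural_map (str p)) :
  exists h : nat, embedding_number C l theta str h /\ (l ^ k %| h)%N.
Proof.
exists 0%N; split; last exact: dvdn0.
have charFl : l \in [pchar F] by rewrite (fmorph_pchar f) pchar_Fp.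
have l2 : ((l ^ 2)%N%:Z %| Delta n)%Z.
  (* The valuation [2k] is at least 2; reading divisibility from it uses [Delta n != 0]. *)
  rewrite dvdzE absz_nat pfactor_dvdn ?hv //.
  by rewrite absz_gt0 /Delta; lia.
rewrite /embedding_number; have -> : embedding_classes C theta str = set0.
  apply/seteqP; split=> // c [iota [ie io _] _].
  exact: (no_optimal_embedding charFl hl E_ss C_cyc hn l2 ie io).
rewrite set0X II0; exact: card_eq00.
Qed.
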